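(* Consider the model below and fix $k\in\{2,\dots,K\}$, $R_t,R_c>0$, $\tau_t=2^{R_t}-1$, $\tau_c=2^{R_c}-1$. The coverage probability of the typical user associated with the tier-$k$ NOMA small cells is $$P_{cov,k}(\tau_c,\tau_t)=\int_0^{r_k}P^{near}_{k}(x_0)\,f_{d_{o,k}}(x_0)\,dx_0+\int_{r_k}^\infty P^{far}_k(x_0)\,f_{d_{o,k}}(x_0)\,dx_0,$$ where, for $x_0\le r_k$, $P^{near}_k(x_0)=0$ if $a_{m,k}-\tau_ca_{n,k}<0$ and otherwise $$P^{near}_{k}(x_0)=\exp\Big\{-\frac{\varepsilon^*x_0^{\alpha_k}\sigma^2}{P_k\eta}-\lambda_1\delta_1\pi\Big(\frac{\tilde P_{1k}\varepsilon^*}{N}\Big)^{\delta_1}x_0^{2\alpha_k/\alpha_1}Q^n_{1,t}-\sum_{i=2}^K\frac{\lambda_i\delta_i\pi\tilde B_{ik}^{\delta_i-1}\tilde P_{ik}^{\delta_i}x_0^{2\alpha_k/\alpha_i}}{1-\delta_i}Q^n_{i,t}\Big\},$$ and, for $x_0>r_k$, $P^{far}_k(x_0)=0$ if $a_{m,k}-\tau_ta_{n,k}<0$ and otherwise $$P^{far}_{k}(x_0)=\exp\Big\{-\frac{\varepsilon_t^fx_0^{\alpha_k}\sigma^2}{P_k\eta}-\lambda_1\delta_1\pi\Big(\frac{\tilde P_{1k}\varepsilon_t^f}{N}\Big)^{\delta_1}x_0^{2\alpha_k/\alpha_1}Q^f_{1,t}-\sum_{i=2}^K\frac{\lambda_i\delta_i\pi\tilde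 B_{ik}^{\delta_i-1}\tilde P_{ik}^{\delta_i}x_0^{2\alpha_k/\alpha_i}}{1-\delta_i}Q^f_{i,t}\Big\}.$$ Here $\varepsilon_t^n=\tau_t/a_{n,k}$, $\varepsilon_c^f=\tau_c/(a_{m,k}-\tau_ca_{n,k})$, $\varepsilon^*=\max\{\varepsilon_c^f,\varepsilon_t^n\}$, $\varepsilon_t^f=\tau_t/(a_{m,k}-\tau_ta_{n,k})$, and for $\varepsilon\in\{\varepsilon^*,\varepsilon_t^f\}$ (superscript $n$ for $\varepsilon^*$, $f$ for $\varepsilon_t^f$) $$Q_{i,t}=\varepsilon\,{}_2F_1\Big(1,1-\delta_i;2-\delta_i;-\frac{\varepsilon}{\tilde B_{ik}}\Big),\qquad Q_{1,t}=\sum_{p=1}^N\binom Np(-1)^{\delta_1-p}B\Big(-\frac{\varepsilon a_{n,k}B_k}{G_M};p-\delta_1,1-N\Big).$$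
   Context: Model: $K\ge2$ tiers of base stations in $\mathbb{R}^2$; tier $i$ forms a homogeneous Poisson point process $\Phi_i$ of intensity $\lambda_i>0$, independent across tiers. Tier 1 (macro) base stations have transmit power $P_1$, $M$ antennas and serve $N$ users by zero-forcing ($M>N\ge2$ integers), array gain $G_M=M-N+1$. Tier $i\ge2$ (small-cell) base stations have one antenna, transmit power $P_i>0$, bias $B_i>0$, NOMA power-sharing coefficients $a_{m,i},a_{n,i}>0$. Path loss $\eta d^{-\alpha_i}$, $\eta>0$, $\alpha_i>2$; noise power $\sigma^2\ge0$; $\delta_i=2/\alpha_i$, $\tilde P_{ik}=P_i/P_k$, $\tilde B_{ik}=B_i/B_k$. The typical user at the origin is associated with a tier-$k$ base station at random distance $d_{o,k}$ with density $$f_{d_{o,k}}(x)=\frac{2\pi\lambda_kx}{A_k}\exp\Big[-\pi\sum_{i=2}^K\lambda_i(\tilde P_{ik}\tilde B_{ik})^{\delta_i}x^{2\alpha_k/\alpha_i}-\pi\lambda_1\Big(\frac{\tilde P_{1k}G_M}{Na_{n,k}B_k}\Big)^{\delta_1}x^{2\alpha_k/\alpha_1}\Big],$$ $A_k$ being the normalizing constant (the tier-$k$ association probability). The serving base station also serves a previously connected user at distance $r_k>0$. Given $d_{o,k}=x_0$: exclusion radii $\omega_{i,k}(x_0)=(\tilde B_{ik}\tilde P_{ik})^{\delta_i/2}x_0^{\alpha_k/\alpha_i}$ ($i\ge2$), $\omega_{1,k}(x_0)=(\tilde P_{1k}G_M/(a_{n,k}B_kN))^{\delta_1/2}x_0^{\alpha_k/\alpha_1}$;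 interference $I_{S,k}=\sum_{i\ge2}\sum_{y\in\Phi_i,|y|>\omega_{i,k}(x_0)}P_ig_y\eta|y|^{-\alpha_i}$ ($g_y$ i.i.d. Exp(1)) and $I_{M,k}=\sum_{y\in\Phi_1,|y|>\omega_{1,k}(x_0)}(P_1/N)g_y\eta|y|^{-\alpha_1}$ ($g_y$ i.i.d. Gamma$(N,1)$); serving fading $g_{o,k}\sim$Exp(1); all independent. Coverage: if $x_0\le r_k$ (near user) the event is $\{\gamma_{k_{n\to m^*}}>\tau_c,\gamma_{k_n}>\tau_t\}$ with $\gamma_{k_{n\to m^*}}=\frac{a_{m,k}P_kg_{o,k}\eta x_0^{-\alpha_k}}{a_{n,k}P_kg_{o,k}\eta x_0^{-\alpha_k}+I_{M,k}+I_{S,k}+\sigma^2}$ and $\gamma_{k_n}=\frac{a_{n,k}P_kg_{o,k}\eta x_0^{-\alpha_k}}{I_{M,k}+I_{S,k}+\sigma^2}$; if $x_0>r_k$ (far user) the event is $\{\gamma_{k_m}>\tau_t\}$ with $\gamma_{k_m}=\frac{a_{m,k}P_kg_{o,k}\eta x_0^{-\alpha_k}}{a_{n,k}P_kg_{o,k}\eta x_0^{-\alpha_k}+I_{M,k}+I_{S,k}+\sigma^2}$; $P_{cov,k}$ is the probability of coverage averaged over $d_{o,k}$. ${}_2F_1$ is the Gauss hypergeometric function, $B(z;a,b)=\int_0^zt^{a-1}(1-t)^{b-1}dt$ (real segment) the incomplete Beta function, and $(-y)^c=y^ce^{i\pi c}$ for $y>0$.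
   Formalization: In the boundary cases a_m = τ_c a_n (near) and a_m = τ_t a_n (far), where ε_c^f or ε_t^f divides by zero, the coverage probability is taken to be 0, so the case split is ≤ 0 instead of < 0; ₂F₁ is given by Euler's integral (continuation to z < 1), and Q_{1,t} is also shown to be real. *)

(* Defs.v *)
From HB Require Import structures.
From mathcomp Require Import all_boot all_order all_algebra.
From mathcomp Require Import all_classical all_reals all_analysis.
From mathcomp Require complex.

Set Implicit Arguments.
Unset Strict Implicit.
Unset Printing Implicit Defensive.

Import Order.TTheory GRing.Theory Num.Theory.
Import numFieldNormedType.Exports.

Local Open Scope classical_set_scope.
Local Open Scope ring_scope.

(* Model parameters.  Tiers are indexed by natural numbers 1..K;     *)
(* tier 1 is the macro tier, tiers 2..K are NOMA small-cell tiers.   *)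
Record hetnet_params (R : realType) := HetNetParams {
  K : nat;            (* number of tiers *)
  M : nat;            (* macro antennas *)
  N : nat;            (* users served by a macro BS *)
  lam : nat -> R;     (* intensities lambda_i *)
  Pw : nat -> R;      (* transmit powers P_i *)
  Bb : nat -> R;      (* biases B_i *)
  am : nat -> R;      (* NOMA coefficient a_{m,i} *)
  an : nat -> R;      (* NOMA coefficient a_{n,i} *)
  alpha : nat -> R;   (* path-loss exponents alpha_i *)
  etaPL : R;            (* path-loss constant *)
  sigma2 : R;         (* noise power *)
}.

Section defs.
Variable R : realType.
Implicit Types (p : hetnet_params R).

Definition delta p i : R := 2 / alpha p i.
Definition Pt p i k : R := Pw p i / Pw p k.
Definition Bt p i k : R := Bb p i / Bb p k.
Definition GM p : R := ((M p - N p)%N + 1)%:R.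

Definition norm2 (y : R * R) : R := Num.sqrt (y.1 ^+ 2 + y.2 ^+ 2).

Definition assoc_exponent p k (x : R) : R :=
  - pi * (\sum_(2 <= i < (K p).+1)
             lam p i * (Pt p i k * Bt p i k) `^ delta p i
               * x `^ (2 * alpha p k / alpha p i))
  - pi * lam p 1 * (Pt p 1 k * GM p / ((N p)%:R * an p k * Bb p k)) `^ delta p 1
               * x `^ (2 * alpha p k / alpha p 1).

Definition dens_unnorm p k (x : R) : R :=
  2 * pi * lam p k * x * expR (assoc_exponent p k x).

(* A_k : the normalising constant (tier-k association probability) *)
Definition Ak p k : R :=
  Rintegral (@lebesgue_measure R) `[0, +oo[ (dens_unnorm p k).

Definition f_do p k (x : R) : R := dens_unnorm p k x / Ak p k.

Definition omega_ik p i k (x0 : R) : R :=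
  (Bt p i k * Pt p i k) `^ (delta p i / 2) * x0 `^ (alpha p k / alpha p i).
Definition omega_1k p k (x0 : R) : R :=
  (Pt p 1 k * GM p / (an p k * Bb p k * (N p)%:R)) `^ (delta p 1 / 2)
    * x0 `^ (alpha p k / alpha p 1).

(* A marked point process is an enumeration of its (position, mark)  *)
(* pairs: X : Omega -> nat -> (R * R) * R.                           *)
Definition count {Omega : Type} (X : Omega -> nat -> (R * R) * R)
    (A : set ((R * R) * R)) (w : Omega) : \bar R :=
  (\sum_(n <oo) (\1_A (X w n))%:E)%E.

Definition intensity (l : R) (rho : R -> R) (A : set ((R * R) * R)) : \bar R :=
  (l%:E * \int[@lebesgue_measure R]_x \int[@lebesgue_measure R]_y
      \int[@lebesgue_measure R]_t ((\1_A ((x, y), t) : R) * rho t)%:E)%E.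

Definition exp_density (t : R) : R := if 0 <= t then expR (- t) else 0.
Definition gamma_density (n : nat) (t : R) : R :=
  if 0 <= t then t ^+ n.-1 * expR (- t) / (n.-1)`!%:R else 0.

Definition mark_density p (i : nat) : R -> R :=
  if i == 1%N then gamma_density (N p) else exp_density.

Definition tier_intensity p (i : nat) := intensity (lam p i) (mark_density p i).

(* Poisson probability mass function (with the correct rate-0 case) *)
Definition poisson_prob (m : R) (j : nat) : R := m ^+ j / j`!%:R * expR (- m).

(* Joint law hypothesis: the tiers are independent marked PPPs on R^2 *)
(* (intensity lam_i, i.i.d. marks with the tier's fading law) and the *)
(* serving fading g_o ~ Exp(1) is independent of all of them.  Stated *)
(* through the finite-dimensional distributions of the counts:       *)
(* counts on disjoint sets of a same tier, counts of distinct tiers   *)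
(* and g_o are mutually independent, counts are Poisson.              *)
Definition hetnet_law p {d : measure_display} {Omega : measurableType d}
    (P : probability Omega R) (X : nat -> Omega -> nat -> (R * R) * R)
    (go : Omega -> R) : Prop :=
  (forall i n, (1 <= i <= K p)%N -> measurable_fun setT (fun w => X i w n)) /\
  measurable_fun setT go /\
  forall (n : nat) (tier : 'I_n -> nat) (A : 'I_n -> set ((R * R) * R))
         (kk : 'I_n -> nat) (G : set R),
    measurable G ->
    (forall j, (1 <= tier j <= K p)%N) ->
    (forall j, measurable (A j)) ->
    (forall j, (tier_intensity p (tier j) (A j) < +oo)%E) ->
    (forall j j', j != j' -> tier j = tier j' -> A j `&` A j' = set0) ->
    P (go @^-1` G `&`
       \bigcap_(j in [set: 'I_n]) [set w | count (X (tier j)) (A j) w = (kk j)%:R%:E])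
    = (Rintegral (@lebesgue_measure R) (G `&` `[0, +oo[) (fun t => expR (- t))
       * \prod_(j < n) poisson_prob (fine (tier_intensity p (tier j) (A j))) (kk j))%:E.

Definition I_S p k {Omega : Type} (X : nat -> Omega -> nat -> (R * R) * R)
    (x0 : R) (w : Omega) : \bar R :=
  (\sum_(2 <= i < (K p).+1)
     \sum_(n <oo)
       (if (omega_ik p i k x0 < norm2 (X i w n).1)%R
        then (Pw p i * (X i w n).2 * etaPL p * norm2 (X i w n).1 `^ (- alpha p i))%:E
        else 0))%E.

Definition I_M p k {Omega : Type} (X : nat -> Omega -> nat -> (R * R) * R)
    (x0 : R) (w : Omega) : \bar R :=
  (\sum_(n <oo)
     (if (omega_1k p k x0 < norm2 (X 1%N w n).1)%R
      then (Pw p 1 / (N p)%:R * (X 1%N w n).2 * etaPL p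
            * norm2 (X 1%N w n).1 `^ (- alpha p 1))%:E
      else 0))%E.

Definition sinr (num base : R) (I : \bar R) (noise : R) : R :=
  if I is r%:E then num / (base + r + noise) else 0.

Definition cond_cov p (k : nat) (r tauc taut : R) {d : measure_display}
    {Omega : measurableType d} (P : probability Omega R)
    (X : nat -> Omega -> nat -> (R * R) * R) (go : Omega -> R) (x0 : R) : R :=
  let S w := Pw p k * go w * etaPL p * x0 `^ (- alpha p k) in
  let I w := (I_M p k X x0 w + I_S p k X x0 w)%E in
  fine (P [set w |
    if x0 <= r then
      (tauc < sinr (am p k * S w) (an p k * S w) (I w) (sigma2 p)) &&
      (taut < sinr (an p k * S w) 0 (I w) (sigma2 p))
    else
      taut < sinr (am p k * S w) (an p k * S w) (I w) (sigma2 p)]).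

Definition Pcov p (k : nat) (r tauc taut : R) {d : measure_display}
    {Omega : measurableType d} (P : probability Omega R)
    (X : nat -> Omega -> nat -> (R * R) * R) (go : Omega -> R) : \bar R :=
  (\int[@lebesgue_measure R]_(x0 in `[0%R, +oo[)
      (cond_cov p k r tauc taut P X go x0 * f_do p k x0)%:E)%E.

(* Gauss hypergeometric function 2F1(a,b;c;z), for c > b > 0, z < 1, *)
(* through Euler's integral representation (analytic continuation of  *)
(* the Gauss series to z in (-oo,1)); the Beta normalisation replaces *)
(* Gamma(c)/(Gamma(b)Gamma(c-b)).                                     *)
Definition hyp2F1 (a b c z : R) : R :=
  Rintegral (@lebesgue_measure R) `[0, 1]
    (fun t => t `^ (b - 1) * (1 - t) `^ (c - b - 1) * (1 - z * t) `^ (- a))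
  / Rintegral (@lebesgue_measure R) `[0, 1]
    (fun t => t `^ (b - 1) * (1 - t) `^ (c - b - 1)).

Local Open Scope complex_scope.
Import complex.

Definition expi (th : R) : R[i] := (cos th +i* sin th).

(* (-y)^c := y^c e^{i pi c} for y > 0 *)
Definition negpow (y c : R) : R[i] := (y `^ c)%:C * expi (pi * c).

(* Incomplete Beta B(z;a,b) = int_0^z t^{a-1}(1-t)^{b-1} dt along the *)
(* real segment, at a negative argument z = -y (y > 0), with the above *)
(* convention for t^{a-1} when t < 0.  Substituting t = -u:            *)
(*   B(-y;a,b) = - int_0^y (-u)^{a-1} (1+u)^{b-1} du.                  *)
Definition incBeta_neg (y a b : R) : R[i] :=
  - (expi (pi * (a - 1)) *
     (Rintegral (@lebesgue_measure R) `[0, y]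
        (fun u => u `^ (a - 1) * (1 + u) `^ (b - 1)))%:C).

Definition Qsmall p (i k : nat) (eps : R) : R :=
  eps * hyp2F1 1 (1 - delta p i) (2 - delta p i) (- (eps / Bt p i k)).

Definition Qmacro p (k : nat) (eps : R) : R[i] :=
  \sum_(1 <= q < (N p).+1)
     ('C(N p, q))%:R%:C * negpow 1 (delta p 1 - q%:R)
       * incBeta_neg (eps * an p k * Bb p k / GM p) (q%:R - delta p 1) (1 - (N p)%:R).

Definition Pform p (k : nat) (eps Q1 x0 : R) : R :=
  expR (- (eps * x0 `^ alpha p k * sigma2 p / (Pw p k * etaPL p))
        - lam p 1 * delta p 1 * pi * (Pt p 1 k * eps / (N p)%:R) `^ delta p 1
            * x0 `^ (2 * alpha p k / alpha p 1) * Q1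
        - \sum_(2 <= i < (K p).+1)
            lam p i * delta p i * pi * Bt p i k `^ (delta p i - 1)
              * Pt p i k `^ delta p i * x0 `^ (2 * alpha p k / alpha p i)
              / (1 - delta p i) * Qsmall p i k eps).

Definition eps_tn p (k : nat) (taut : R) : R := taut / an p k.
Definition eps_cf p (k : nat) (tauc : R) : R := tauc / (am p k - tauc * an p k).
Definition eps_star p (k : nat) (tauc taut : R) : R :=
  Num.max (eps_cf p k tauc) (eps_tn p k taut).
Definition eps_tf p (k : nat) (taut : R) : R := taut / (am p k - taut * an p k).

Definition Pnear p (k : nat) (tauc taut x0 : R) : R :=
  if am p k - tauc * an p k <= 0 then 0
  else Pform p k (eps_star p k tauc taut)
         (Re (Qmacro p k (eps_star p k tauc taut))) x0.

Definition Pfar p (k : nat) (taut x0 : R) : R :=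
  if am p k - taut * an p k <= 0 then 0
  else Pform p k (eps_tf p k taut) (Re (Qmacro p k (eps_tf p k taut))) x0.

(* imaginary part of Q_{1,t} (the formula presupposes it is real) *)
Definition Qmacro_Im p (k : nat) (eps : R) : R := Im (Qmacro p k eps).
End defs.

(* Main.v *)
(** Fix the serving distance [x0].  Almost surely the marks, the serving fading and the
   total interference [I] are positive, and the coverage event is then
   [s * (I + sigma2) < go] with [s = eps * x0 ^ alpha_k / (P_k * eta)], where [eps] is
   [eps_star] for the near user and [eps_tf] for the far user; it is a null event when
   [a_m - tau * a_n <= 0].

   Since [go] is exponential and independent of the point processes, the probability of
   [s * (I + sigma2) < go] is the Laplace transform of the shot noise [I] at [s].  The
   hypothesis only gives the joint law of finitely many counts, so the transform is first
   computed for simple functions of bounded support by summing over the values of the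
   counts.  Approximating from below bounds the probability from above; the reverse bound
   comes from approximating [c * I] with [c > 1], since [c * (I + sigma2) <= go] forces
   [I + sigma2 < go] when [0 < go], and [1 - exp(- c u) <= c (1 - exp(- u))] lets [c] tend
   to 1.

   Each tier contributes the integral of [1 - (1 + C |y| ^ (- alpha)) ^ (- n)] over
   [|y| > omega].  Polar integration (the image of planar Lebesgue measure under
   [|y| ^ 2] is [pi] times Lebesgue measure) and the substitution
   [v = C |y| ^ (- alpha)] give
   [pi * delta * C ^ delta * \int_0^kappa (1 - (1 + v) ^ (- n)) v ^ (- delta - 1) dv],
   which is Euler's integral for [2F1] when [n = 1], and becomes the sum of incomplete
   Beta functions after expanding [(1 + v) ^ N - 1]: the phases of
   [(-1) ^ (delta - p)] and of [B(- y; p - delta, 1 - N)] multiply to [exp(- i pi)],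
   cancelling the sign of the latter. *)

Require Import Defs.
From HB Require Import structures.
From mathcomp Require Import all_boot all_order all_algebra.
From mathcomp Require Import finmap.
From mathcomp Require Import all_classical all_reals all_analysis.
From mathcomp Require Import ring lra.
From mathcomp Require Import measurable_realfun.
From mathcomp Require complex.

Set Implicit Arguments.
Unset Strict Implicit.
Unset Printing Implicit Defensive.

Import Order.TTheory GRing.Theory Num.Theory.
Import numFieldNormedType.Exports.
Local Open Scope classical_set_scope.
Local Open Scope ring_scope.

(** * Sums of independent Poisson counts *)

Lemma nneseries_exp_coeff (R : realType) (x : R) : 0 <= x ->
  (\sum_(k <oo) (x ^+ k / k`!%:R)%:E = (expR x)%:E)%E.
Proof.
move=> x0; rewrite expRE -EFin_lim; last first.
  rewrite /pseries/=; under eq_fun do rewrite mulrC.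
  exact: is_cvg_series_exp_coeff.
apply/congr_lim/funext => n/=; rewrite /pseries/= /series/= -sumEFin//.
by under eq_bigr do rewrite mulrC.
Qed.

Lemma poisson_prob_ge0 (R : realType) (m : R) k :
  0 <= m -> 0 <= Defs.poisson_prob m k.
Proof. by move=> m0; rewrite mulr_ge0 ?expR_ge0 ?divr_ge0 ?exprn_ge0. Qed.

(** The weight [expR (- (c * k))] is absorbed into the rate, [m] becoming [m * expR (- c)], and the
    exponential series sums. The offset [a] is kept because the induction of [P_E] lets it grow with
    each count. *)
Lemma poisson_laplace (R : realType) (m c a : R) : 0 <= m ->
  (\sum_(k <oo) (expR (- (a + c * k%:R)) * Defs.poisson_prob m k)%:E =
   (expR (- a) * expR (- (m * (1 - expR (- c)))))%:E)%E.
Proof.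
move=> m0.
transitivity (\sum_(k <oo) ((expR (- a - m))%:E *
    ((m * expR (- c)) ^+ k / k`!%:R)%:E))%E.
  apply: eq_eseriesr => k _; rewrite -EFinM; congr EFin.
  rewrite /Defs.poisson_prob exprMn -expRM_natl !opprD !expRD.
  rewrite [k%:R * - c]mulrC mulNr.
  by ring.
rewrite nneseriesZl; last first.
  by move=> k _; rewrite lee_fin divr_ge0 ?exprn_ge0 ?mulr_ge0 ?expR_ge0.
rewrite nneseries_exp_coeff ?mulr_ge0 ?expR_ge0// -EFinM -!expRD.
by congr ((expR _)%:E); ring.
Qed.

Lemma probability_setI1 {R : realType} {d : measure_display}
    {T : measurableType d} (P : probability T R) (A B : set T) :
  measurable A -> measurable B -> P B = 1%E -> P A = P (A `&` B).
Proof.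
move=> mA mB PB.
rewrite [LHS](measureDI P mA mB) [X in (X + _)%E](_ : _ = 0%E) ?add0e//.
apply/eqP; rewrite eq_le measure_ge0 andbT.
have := probability_setC P mB; rewrite PB subee// => <-.
by apply: le_measure; rewrite ?inE; [exact: measurableD|exact: measurableC|apply: subDsetr].
Qed.

Section finite_counts.
Context {R : realType} {d : measure_display} {Omega : measurableType d}.
Variables (P : probability Omega R) (go : Omega -> R) (n : nat).
Variables (N : nat -> Omega -> \bar R) (mu : nat -> R).
Hypothesis mgo : measurable_fun setT go.
Hypothesis mN : forall j, measurable_fun setT (N j).
Hypothesis mu0 : forall j, (j < n)%N -> 0 <= mu j.
Hypothesis Nnat : forall j, (j < n)%N ->
  P (\bigcup_k [set w | N j w = k%:R%:E]) = 1%E.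
Hypothesis joint : forall (kk : nat -> nat) (a : R), 0 <= a ->
  P ([set w | a < go w] `&`
     [set w | forall j, (j < n)%N -> N j w = (kk j)%:R%:E]) =
  (expR (- a) * \prod_(j < n) Defs.poisson_prob (mu j) (kk j))%:E.
Variable c : nat -> R.
Hypothesis c0 : forall j, 0 <= c j.

(** Interpolates between the hypothesis [joint] at [m = 0], where every count has a prescribed
    value, and the event of [finite_counts_laplace] at [m = n], where every count enters the
    threshold for [go]. *)
Let E m (kk : nat -> nat) (a : R) :=
  [set w | (a%:E + \sum_(0 <= j < m) (c j)%:E * N j w < (go w)%:E)%E] `&`
  [set w | forall j, (m <= j < n)%N -> N j w = (kk j)%:R%:E].

Let measurable_N j (x : \bar R) : measurable [set w | N j w = x].
Proof. by rewrite -[X in measurable X]setTI; exact: (mN j measurableT (emeasurable_set1 x)). Qed.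

Let measurable_E m kk a : measurable (E m kk a).
Proof.
apply: measurableI.
  rewrite -[X in measurable X]setTI; apply: measurable_lte => //.
    apply: emeasurable_funD => //; apply: emeasurable_sum => j.
    exact: measurable_funeM.
  exact/measurable_EFinP.
rewrite (_ : [set w | _] =
    \bigcap_(j in [set j | (m <= j < n)%N]) [set w | N j w = (kk j)%:R%:E]).
  by apply: bigcap_measurableType => j _; exact: measurable_N.
by apply/seteqP; split.
Qed.

(** Induction on [m]: almost surely [N m] is some natural number [k], and on that event [E m.+1]
    becomes [E m] with the threshold raised by [c m * k]. Countable additivity leaves a Poisson
    series, summed by [poisson_laplace]. *)
Let P_E m kk a : (m <= n)%N -> 0 <= a ->
  P (E m kk a) = (expR (- a) *
    \prod_(0 <= j < m) expR (- (mu j * (1 - expR (- c j)))) *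
    \prod_(m <= j < n) Defs.poisson_prob (mu j) (kk j))%:E.
Proof.
elim: m kk a => [|m IH] kk a mn a0.
  rewrite [in X in _ * X * _]big_geq// mulr1 big_mkord -joint//; congr (P _).
  apply/seteqP; split => w [/= h1 h2]; split => //=; move: h1;
    by rewrite big_geq// adde0 lte_fin.
(* In [E m] the count [m] is prescribed again, with the value [k] over which the union below is
   taken. *)
pose upd k j := if j == m then k else kk j.
have updE k : \prod_(m <= j < n) Defs.poisson_prob (mu j) (upd k j) =
    Defs.poisson_prob (mu m) k * \prod_(m.+1 <= j < n) Defs.poisson_prob (mu j) (kk j).
  rewrite big_ltn// /upd eqxx; congr (_ * _); rewrite !big_nat.
  by apply: eq_bigr => j /andP[mj _]; rewrite gtn_eqF.
have split_E : E m.+1 kk a `&` \bigcup_k [set w | N m w = k%:R%:E] =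
    \bigcup_k E m (upd k) (a + c m * k%:R).
  rewrite setI_bigcupr; apply: eq_bigcup => // k _.
  apply/seteqP; split => w.
    move=> [[/= h1 h2] h3]; split => /=.
      move: h1; rewrite big_nat_recr//= h3 -EFinM [X in (a%:E + X)%E]addeC addeA.
      by rewrite -EFinD.
    move=> j /andP[mj jn]; rewrite /upd; case: eqP => [->//|/eqP jm].
    by apply: h2; rewrite ltn_neqAle eq_sym jm mj.
  move=> [/= h1 h2].
  have Nm : N m w = k%:R%:E.
    by rewrite h2 ?leqnn//= /upd eqxx.
  split => //; split => /=.
    rewrite big_nat_recr//= Nm -EFinM [X in (a%:E + X)%E]addeC addeA.
    by rewrite -EFinD.
  move=> j /andP[mj jn].
  by rewrite h2 ?(ltnW mj)//= /upd gtn_eqF.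
have mNat : measurable (\bigcup_k [set w | N m w = k%:R%:E]).
  by apply: bigcupT_measurable => k; exact: measurable_N.
rewrite (probability_setI1 (measurable_E _ _ _) mNat (Nnat mn)) split_E measure_bigcup//=; last first.
  move=> k1 k2 _ _ [w [[_ /= h1] [_ /= h2]]].
  have := h1 m; rewrite h2 ?leqnn//= /upd eqxx => /(_ mn) /eqP.
  by rewrite eqe eqr_nat => /eqP ->.
rewrite (@eq_eseriesl _ _ xpredT); last by move=> k; rewrite in_setT.
transitivity (\sum_(k <oo) (\prod_(0 <= j < m) expR (- (mu j * (1 - expR (- c j)))) * 
    \prod_(m.+1 <= j < n) Defs.poisson_prob (mu j) (kk j))%:E *
    (expR (- (a + c m * k%:R)) * Defs.poisson_prob (mu m) k)%:E)%E.
  apply: eq_eseriesr => k _.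
  rewrite IH ?(ltnW mn)//; last by rewrite addr_ge0// mulr_ge0.
  by rewrite updE -EFinM; congr EFin; ring.
rewrite nneseriesZl; last first.
  move=> k _; rewrite lee_fin mulr_ge0 ?expR_ge0// poisson_prob_ge0// mu0//.
rewrite poisson_laplace ?mu0// -EFinM big_nat_recr//=.
by congr EFin; ring.
Qed.

(** The endpoint [m = n] of the interpolation. Since [go] is exponential, the probability that it
    exceeds an independent nonnegative sum is the Laplace transform of that sum, here a product of
    Poisson factors. *)
Lemma finite_counts_laplace (a : R) : 0 <= a ->
  P [set w | (a%:E + \sum_(0 <= j < n) (c j)%:E * N j w < (go w)%:E)%E] =
  (expR (- a) * \prod_(0 <= j < n) expR (- (mu j * (1 - expR (- c j)))))%:E.
Proof.
move=> a0; have := P_E (fun=> 0%N) (leqnn n) a0.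
rewrite [in X in _ * _ * X]big_geq// mulr1 => <-; congr (P _).
apply/seteqP; split => w //=; last by case.
by split => // j /andP[]; rewrite leqNgt => /negP.
Qed.

End finite_counts.

(** * Gamma integrals and polar integration *)

Section gamma_integral.
Context {R : realType}.
Notation leb := (@lebesgue_measure R).

Lemma FTC2_global (f F : R -> R) (a b : R) : a < b -> continuous f ->
  (forall x : R, is_derive x 1 F (f x)) ->
  (\int[leb]_(x in `[a, b]) (f x)%:E = (F b - F a)%:E)%E.
Proof.
move=> ab cf dF.
have cF : continuous F.
  by move=> t; apply/differentiable_continuous/derivable1_diffP; exact: (@ex_derive _ _ _ _ _ _ _ (dF t)).
rewrite (@continuous_FTC2 _ f F)//.
- exact: continuous_subspaceT.
- split; first by move=> x _; exact: (@ex_derive _ _ _ _ _ _ _ (dF x)).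
  + exact/cvg_at_right_filter/cF.
  + exact/cvg_at_left_filter/cF.
- by move=> x _; rewrite derive1E; exact: (@derive_val _ _ _ _ _ _ _ (dF x)).
Qed.

(** Keeps the single term of order [n.+1] of the exponential series; this is the decay at infinity
    behind [cvg_gamma_tail]. *)
Lemma le_expnMexpRN (n : nat) (x : R) : 0 < x ->
  x ^+ n * expR (- x) <= n.+1`!%:R / x.
Proof.
move=> x0; rewrite ler_pdivlMr// expRN mulrAC -exprSr.
rewrite ler_pdivrMr ?expR_gt0// mulrC -ler_pdivrMr ?ltr0n ?fact_gt0//.
by apply: le_trans (expR_ge1Dxn n (ltW x0)); rewrite lerDr.
Qed.

(** Survival function of the Gamma law of shape [n.+1] and rate [b]. Its terms telescope under
    differentiation, leaving minus the density, so it supplies the antiderivative for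
    [integral_gamma]. *)
Definition gamma_tail (b : R) (n : nat) (t : R) : R :=
  \sum_(0 <= j < n.+1) (b * t) ^+ j / j`!%:R * expR (- (b * t)).

Lemma is_derive_mull (b x : R) : is_derive x 1 (fun u : R => b * u) b.
Proof.
have h := is_deriveZ b (is_derive_id x 1).
by rewrite [b *: 1]mulr1 in h.
Qed.

Lemma is_derive_gamma_tail (b : R) n (t : R) :
  is_derive t 1 (gamma_tail b n) (- (b * (b * t) ^+ n / n`!%:R * expR (- (b * t)))).
Proof.
have dexp : is_derive t 1 (fun u : R => expR (- (b * u))) (- (b * expR (- (b * t)))).
  have h : is_derive t 1 (fun u : R => - (b * u)) (- b) by exact: is_deriveN (is_derive_mull b t).
  have h2 := @is_derive1_comp _ expR (fun u : R => - (b * u)) t _ _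
    (is_derive_expR (- (b * t))) h.
  by apply: (is_derive_eq h2); rewrite mulrN mulrC.
elim: n => [|n IH].
  rewrite (_ : gamma_tail b 0 = fun u => expR (- (b * u))).
    by apply: is_derive_eq; rewrite expr0 fact0 divr1 mulr1.
  by apply/funext => u; rewrite /gamma_tail big_nat1 expr0 fact0 divr1 mul1r.
have dX : is_derive t 1 (fun u : R => (b * u) ^+ n.+1) (n.+1%:R * (b * t) ^+ n * b).
  have h := is_deriveX n.+1 (is_derive_mull b t); rewrite exprfctE in h.
  by apply: (is_derive_eq h); rewrite /GRing.scale/=; ring.
have dX' : is_derive t 1 (fun u : R => n.+1`!%:R^-1 * (b * u) ^+ n.+1)
    (n.+1`!%:R^-1 * (n.+1%:R * (b * t) ^+ n * b)) by exact: is_deriveZ.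
have h := is_deriveD IH (is_deriveM dX' dexp).
have E : gamma_tail b n.+1 = gamma_tail b n +
    (fun u : R => n.+1`!%:R^-1 * (b * u) ^+ n.+1) * (fun u => expR (- (b * u))).
  apply/funext => u.
  transitivity (gamma_tail b n u + n.+1`!%:R^-1 * (b * u) ^+ n.+1 * expR (- (b * u))).
    by rewrite /gamma_tail [LHS]big_nat_recr//= [X in _ + X * _ = _]mulrC.
  by [].
rewrite E; apply: (is_derive_eq h).
rewrite /GRing.scale/= factS natrM.
have : (n`!%:R : R) != 0 by rewrite pnatr_eq0 -lt0n fact_gt0.
have : (n.+1%:R : R) != 0 by rewrite pnatr_eq0.
by move=> h1 h2; rewrite exprS; field; rewrite h2 addrC natr1 h1.
Qed.

Lemma cvg_gamma_tail b n : 0 < b -> gamma_tail b n t @[t --> +oo] --> (0:R).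
Proof.
move=> b0.
apply: (@squeeze_cvgr _ _ _ _ (cst 0) (fun t => (\sum_(0 <= j < n.+1) j.+1`!%:R / j`!%:R) * (b * t)^-1)).
- near=> t; have t0 : 0 < t by near: t; exact: nbhs_pinfty_gt.
  have bt0 : 0 < b * t by rewrite mulr_gt0.
  apply/andP; split.
    by apply: sumr_ge0 => j _; rewrite mulr_ge0 ?expR_ge0// divr_ge0// exprn_ge0// ltW.
  rewrite /gamma_tail mulr_suml; apply: ler_sum => j _.
  rewrite mulrAC [leRHS]mulrAC ler_wpM2r ?invr_ge0//.
  exact: le_expnMexpRN.
- exact: cvg_cst.
- have cv : (b * t)^-1 @[t --> +oo] --> (0:R).
    apply/gtr0_cvgV0; last by exact: gt0_cvgMry b0 (cvg_id).
    by near=> u; rewrite mulr_gt0//; near: u; exact: nbhs_pinfty_gt.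
  have := cvgMl_tmp (a := \sum_(0 <= j < n.+1) j.+1`!%:R / j`!%:R) cv.
  by rewrite mulr0; exact.
Unshelve. all: by end_near. Qed.

Lemma integral_gamma b n : 0 < b ->
  (\int[leb]_(t in `[0%R, +oo[) (t ^+ n * expR (- (b * t)) / n`!%:R)%:E =
   ((b ^+ n.+1)^-1)%:E)%E.
Proof.
move=> b0; pose F t := - (b ^+ n.+1)^-1 * gamma_tail b n t.
have dF (x : R) : is_derive x 1 F (x ^+ n * expR (- (b * x)) / n`!%:R).
  apply: is_derive_eq; first exact: (is_deriveZ _ (is_derive_gamma_tail b n x)).
  rewrite /GRing.scale/= exprMn exprS.
  have : (n`!%:R : R) != 0 by rewrite pnatr_eq0 -lt0n fact_gt0.
  have : b ^+ n != 0 by rewrite expf_neq0// gt_eqF.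
  by move=> h1 h2; field; rewrite h1 h2 gt_eqF.
have cF : continuous F.
  by move=> t; apply/differentiable_continuous/derivable1_diffP; exact: (@ex_derive _ _ _ _ _ _ _ (dF t)).
rewrite (@ge0_continuous_FTC2y _ _ F 0 0)//.
- rewrite /F /gamma_tail big_nat_recl// mulr0 expr0 fact0 oppr0 expR0 big1.
    by rewrite -EFinB; congr EFin; rewrite divr1 addr0 !mulr1 sub0r opprK.
  by move=> j _; rewrite exprS !mul0r.
- by move=> x x0; rewrite divr_ge0// mulr_ge0 ?expR_ge0// exprn_ge0.
- apply: continuous_subspaceT => x.
  apply: cvgM; last exact: cvg_cst.
  apply: cvgM; first exact: exprn_continuous.
  apply: continuous_comp; last exact: continuous_expR.
  by apply: cvgN; exact: mulrl_continuous.
- rewrite -(mulr0 (- (b ^+ n.+1)^-1)); apply: cvgM; first exact: cvg_cst.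
  exact: cvg_gamma_tail.
- exact/cvg_at_right_filter/cF.
- by move=> x _; rewrite derive1E; exact: (@derive_val _ _ _ _ _ _ _ (dF x)).
Qed.
End gamma_integral.

(** * Planar Lebesgue measure seen through the squared radius *)

Section disk.
Context {R : realType}.
Notation leb := (@lebesgue_measure R).

(** The substitution [x = s * sin t] turns the integrand into [2 * r * cos t ^+ 2], whose
    antiderivative is [r * (t + sin t * cos t)]. *)
Lemma integral_half_disk (r : R) : 0 < r ->
  (\int[leb]_(x in `[(- Num.sqrt r)%R, Num.sqrt r]) (2 * Num.sqrt (r - x ^+ 2))%:E
   = (pi * r)%:E)%E.
Proof.
move=> r0; set s := Num.sqrt r.
have s0 : 0 < s by rewrite sqrtr_gt0.
have pi2 : - (pi / 2) < (pi / 2 : R) by have := @pi_gt0 R; lra.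
pose F (t : R) := s * sin t.
have dF (t : R) : is_derive t 1 F (s * cos t) by exact: is_deriveZ.
have F'E : derive1 F = (fun t => s * cos t).
  by apply/funext => t; rewrite derive1E; apply: derive_val.
have cF' : continuous (fun t => s * cos t).
  by move=> t; apply: cvgMl_tmp; exact: continuous_cos.
have cF : continuous F by move=> t; apply: cvgMl_tmp; exact: continuous_sin.
have -> : `[- s, s]%classic = `[F (- (pi / 2)), F (pi / 2)]%classic.
  by rewrite /F sinN sin_pihalf mulrN mulr1.
rewrite integration_by_substitution_increasing ?(ltW pi2)//; last 6 first.
- move=> x y xI yI xy; rewrite /F ltr_pM2l//.
  by rewrite ltr_sin.
- by rewrite F'E => t _; exact: cF'.
- by rewrite F'E; apply/cvg_ex; eexists; exact/cvg_at_right_filter/cF'.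
- by rewrite F'E; apply/cvg_ex; eexists; exact/cvg_at_left_filter/cF'.
- split; first by move=> x _.
  + exact/cvg_at_right_filter/cF.
  + exact/cvg_at_left_filter/cF.
- apply: continuous_subspaceT => x; apply: cvgMl_tmp.
  apply: continuous_comp; last exact: sqrt_continuous.
  apply: cvgB; first exact: cvg_cst.
  exact: exprn_continuous.
rewrite F'E.
transitivity (\int[leb]_(x in `[(- (pi / 2))%R, (pi / 2)%R]) (2 * r * cos x ^+ 2)%:E)%E.
  apply: eq_integral => t; rewrite inE/= in_itv/= => tI; congr EFin.
  rewrite !fctE /= /F; have -> : r - (s * sin t) ^+ 2 = (s * cos t) ^+ 2.
    by rewrite !exprMn sqr_sqrtr ?(ltW r0)// cos2sin2; ring.
  have ct : 0 <= cos t by apply: cos_ge0_pihalf.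
  rewrite sqrtr_sqr ger0_norm; last by rewrite mulr_ge0// ltW.
  by rewrite -[r in RHS]sqr_sqrtr ?(ltW r0)// -/s; ring.
apply: etrans; first apply: (@FTC2_global _ _ (fun t => r * (t + sin t * cos t))) => //; last first.
- by congr EFin; rewrite sinN cosN cos_pihalf; field.
- move=> x; have h := is_deriveZ r (is_deriveD (is_derive_id x 1)
    (is_deriveM (is_derive_sin x) (is_derive_cos x))).
  apply: (is_derive_eq h); rewrite /GRing.scale/=.
  by rewrite mulrN -[sin x * sin x]expr2 sin2cos2; ring.
- have cc : continuous (fun x : R => 2 * r * cos x ^+ 2).
    move=> x; apply: cvgMl_tmp; apply: (@continuous_comp _ _ _ cos (fun y : R => y ^+ 2)).
      exact: continuous_cos.
    exact: exprn_continuous.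
  exact: cc.
Qed.

Let rad2 (y : R * R) : R := y.1 ^+ 2 + y.2 ^+ 2.

Lemma measurable_rad2 : measurable_fun setT rad2.
Proof.
by apply: measurable_funD; apply: measurable_funX;
  [exact: measurable_fst|exact: measurable_snd].
Qed.

Let disk (r : R) : set (R * R) := [set y | rad2 y <= r].

Let measurable_disk r : measurable (disk r).
Proof.
have := measurable_rad2 measurableT (measurable_itv `]-oo, r]).
by rewrite setTI; congr measurable; apply/seteqP; split => y; rewrite /= in_itv.
Qed.

(** Integrates the lengths of the sections at fixed first coordinate. The maximum accounts for
    negative [r], where the disk is empty and which the intervals of [polar_measure] reach. *)
Lemma disk_area (r : R) : (leb \x leb)%E (disk r) = (pi * Num.max r 0)%:E.
Proof.
have sectionE (x : R) : leb (xsection (disk r) x) = (2 * Num.sqrt (r - x ^+ 2))%:E.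
  have [rx|rx] := ltP (r - x ^+ 2) 0.
    rewrite (_ : xsection _ _ = set0) ?measure0 ?ltr0_sqrtr ?mulr0//.
    apply/seteqP; split => // y /=; rewrite /xsection/= inE /disk/rad2/= => h.
    by have := sqr_ge0 y; lra.
  rewrite (_ : xsection _ _ = `[(- Num.sqrt (r - x ^+ 2))%R, Num.sqrt (r - x ^+ 2)]%classic).
    rewrite lebesgue_measure_itv/= lte_fin; case: ifPn => h.
      by rewrite -EFinB; congr EFin; ring.
    by have := sqrtr_ge0 (r - x ^+ 2) => h'; congr EFin; lra.
  apply/seteqP; split => y; rewrite /xsection/= inE /disk/rad2/= in_itv/=.
    move=> h; rewrite -ler_norml -sqrtr_sqr ler_wsqrtr//; lra.
  rewrite -ler_norml => h; rewrite -lerBrDl -[leRHS]sqr_sqrtr//.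
  by rewrite -[y ^+ 2]real_normK ?num_real// ler_pXn2r// nnegrE sqrtr_ge0.
rewrite /product_measure1/=; under eq_integral do rewrite sectionE.
have [r0|r0] := ltP 0 r; last first.
  rewrite integral0_eq ?mulr0// => x _.
  by rewrite ler0_sqrtr ?mulr0//; have := sqr_ge0 x; lra.
rewrite -integral_half_disk// [RHS]integral_mkcond; apply: eq_integral => x _.
rewrite patchE; case: ifPn => //; rewrite notin_setE/= in_itv/= -ler_norml => /negP.
rewrite -ltNge -sqrtr_sqr => h; rewrite ler0_sqrtr ?mulr0//.
rewrite subr_le0 leNgt; apply/negP => h'; move: h.
by rewrite ltNge ler_wsqrtr// ltW.
Qed.

(** Both sides are measures in [A] that agree on the half-open intervals []a, b]], by differences of
    disk areas. These form a generating family stable under intersection, and the intervals []- k,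
    k]] exhaust the line with finite measure. *)
Lemma polar_measure (A : set R) : measurable A -> A `<=` `[0, +oo[ ->
  (leb \x leb)%E (rad2 @^-1` A) = (pi%:E * leb A)%E.
Proof.
move=> mA A0.
pose phi : R * R -> measurableTypeR R := rad2.
have mphi : measurable_fun setT phi by exact: measurable_rad2.
have mI : measurable (`[0, +oo[%classic : set (measurableTypeR R)) by [].
have pi0 : 0 <= (pi : R) by exact: pi_ge0.
have [m1 m1D] : exists m : {measure set (measurableTypeR R) -> \bar R},
    forall B, m B = (leb \x leb)%E (phi @^-1` B).
  pose m := (pushforward (leb \x leb)%E phi : {measure set (measurableTypeR R) -> \bar R}).
  by exists (m mphi).
(* The restriction to nonnegative reals reflects that [rad2] is never negative; it makes the two
   measures agree on the whole line. *)
pose m2 : {measure set (measurableTypeR R) -> \bar R} := mscale (NngNum pi0) (mrestr leb mI).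
have m1E (a b : R) : a <= b -> m1 `]a, b]%classic = (pi * Num.max b 0 - pi * Num.max a 0)%:E.
  move=> ab; rewrite m1D (_ : _ @^-1` _ = disk b `\` disk a).
    rewrite measureD; [|exact: measurable_disk|exact: measurable_disk|]; last first.
      by rewrite [X in (X < _)%E]disk_area ltry.
    rewrite setIidr; last by move=> y; rewrite /disk/= => h; exact: le_trans h ab.
    by rewrite [X in (X - _)%E]disk_area [X in (_ - X)%E]disk_area EFinB.
  apply/seteqP; split => y; rewrite /disk/= in_itv/=.
    by move=> /andP[h1 ->]; split => //; apply/negP; rewrite -ltNge.
  by move=> [-> /negP]; rewrite -ltNge => ->.
have m2E (a b : R) : a <= b -> m2 `]a, b]%classic = (pi * Num.max b 0 - pi * Num.max a 0)%:E.
  move=> ab; rewrite /m2/= /mscale/= /mrestr -mulrBr EFinM; congr (_ * _)%E.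
  have [a0|a0] := ltP a 0.
    have [b0|b0] := ltP b 0.
      rewrite (_ : _ `&` _ = set0) ?measure0 ?subrr//.
      by apply/seteqP; split => // x /=; rewrite !in_itv/=; lra.
    rewrite (_ : _ `&` _ = `[0, b]%classic); last first.
      by apply/seteqP; split => // x /=; rewrite !in_itv/=; lra.
    rewrite lebesgue_measure_itv/= lte_fin; case: ifPn => h; first by rewrite sube0 subr0.
    by congr EFin; lra.
  rewrite (_ : _ `&` _ = `]a, b]%classic); last first.
    by apply/seteqP; split => // x /=; rewrite !in_itv/=; lra.
  rewrite lebesgue_measure_itv/= lte_fin (max_idPl (le_trans a0 ab)).
  case: ifPn => h; first by rewrite EFinB.
  by congr EFin; lra.
suff : m1 A = m2 A.
  by rewrite m1D => ->; rewrite /m2/= /mscale/= /mrestr setIidl.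
apply: (@measure_unique _ R (measurableTypeR R) (@ocitv R)
    (fun k : nat => `](- k%:R)%R, k%:R]%classic)) => //.
- exact: ocitvI.
- by move=> k; exists (- k%:R, k%:R).
- apply/seteqP; split => // x _; exists (Num.trunc `|x|).+1 => //=.
  have := truncnS_gt `|x|; rewrite in_itv/= => h.
  by move: (ler_norm x) (ler_norm (- x)); rewrite normrN; lra.
- move=> B [[a b] _ <-] /=; have [ab|ab] := leP a b; first by rewrite m1E// m2E.
  by rewrite set_itv_ge ?measure0// bnd_simp -leNgt ltW.
- by move=> k; rewrite m1E ?ltry//; rewrite (@le_trans _ _ 0)// oppr_le0.
Qed.

Lemma polar_integral (h : R -> \bar R) : measurable_fun setT h ->
  (forall x, 0 <= h x)%E ->
  (\int[leb \x leb]_y h (y.1 ^+ 2 + y.2 ^+ 2)%R =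
   pi%:E * \int[leb]_(u in `[0%R, +oo[) h u)%E.
Proof.
move=> mh h0.
have pi0 : 0 <= (pi : R) by exact: pi_ge0.
have mI : measurable (`[0, +oo[%classic : set R) by [].
rewrite -(ge0_integral_mscale leb mI (NngNum pi0))//; last exact: measurable_funTS.
pose phi : R * R -> measurableTypeR R := rad2.
pose m := (pushforward (leb \x leb)%E phi : {measure set (measurableTypeR R) -> \bar R}).
rewrite (eq_measure_integral (m measurable_rad2)); last first.
  by move=> B mB BI; rewrite /pushforward [RHS]polar_measure.
have mhI : measurable_fun (`[0, +oo[%classic : set R) h by exact: measurable_funTS.
have := @ge0_integral_pushforward _ _ (measurableTypeR R * measurableTypeR R)%type
  (measurableTypeR R) R phi measurable_rad2 (leb \x leb)%E _ _ mI mhI.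
rewrite (_ : phi @^-1` _ = setT); last first.
  by apply/seteqP; split => // y _; rewrite /= in_itv/= andbT addr_ge0 ?sqr_ge0.
by move=> ->.
Qed.
End disk.

(** * Counts of the marked point processes *)

Section exponential_tail.
Context {R : realType}.
Notation leb := (@lebesgue_measure R).

Lemma Rintegral_exp_tail (a : R) : 0 <= a ->
  Rintegral leb (`]a, +oo[ `&` `[0, +oo[) (fun t => expR (- t)) = expR (- a).
Proof.
move=> a0; rewrite setIidl; last first.
  by move=> t /=; rewrite !in_itv/= !andbT => h; rewrite ltW// (le_lt_trans a0).
have cE : continuous (fun t : R => expR (- t)).
  by move=> t; apply: continuous_comp; [exact: opp_continuous|exact: continuous_expR].
have dF (x : R) : is_derive x 1 (fun t : R => - expR (- t)) (expR (- x)).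
  have h := is_deriveN (@is_derive1_comp _ expR -%R x _ _
    (is_derive_expR (- x)) (is_deriveNid x 1)).
  by apply: (is_derive_eq h); rewrite mulrN1 opprK.
rewrite /Rintegral integral_itv_obnd_cbnd; last first.
  apply: measurable_funTS; apply/measurable_EFinP.
  exact: continuous_measurable_fun.
rewrite (@ge0_continuous_FTC2y _ _ (fun t => - expR (- t)) a 0)//.
- by rewrite sub0e -EFinN opprK.
- exact: continuous_subspaceT.
- rewrite -oppr0; apply: cvgN; exact: cvgr_expR.
- by apply/cvg_at_right_filter; apply: cvgN; exact: cE.
- by move=> x _; rewrite derive1E; exact: (@derive_val _ _ _ _ _ _ _ (dF x)).
Qed.

Lemma Rintegral_exp_ge0 :
  Rintegral leb (setT `&` `[0, +oo[) (fun t => expR (- t)) = 1.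
Proof.
rewrite setTI -[RHS]expR0 -[in RHS]oppr0 -Rintegral_exp_tail// setIidl; last first.
  by move=> t /=; rewrite !in_itv/= !andbT => h; rewrite ltW.
rewrite /Rintegral integral_itv_obnd_cbnd//.
apply: measurable_funTS; apply/measurable_EFinP.
apply: continuous_measurable_fun => t.
by apply: continuous_comp; [exact: opp_continuous|exact: continuous_expR].
Qed.

End exponential_tail.

Section marked_counts.
Context {R : realType} (p : hetnet_params R) {d : measure_display}
  {Omega : measurableType d} (P : probability Omega R)
  (X : nat -> Omega -> nat -> (R * R) * R) (go : Omega -> R).
Hypothesis law : hetnet_law p P X go.

Let mX i n : (1 <= i <= K p)%N -> measurable_fun setT (fun w => X i w n).
Proof. by case: law => + _; exact. Qed.

Let mgo : measurable_fun setT go.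
Proof. by case: law => _ []. Qed.

Let joint_law := (proj2 (proj2 law)).

Lemma tail_serving_fading (a : R) : 0 <= a ->
  P [set w | a < go w] = (expR (- a))%:E.
Proof.
move=> a0.
(* With an empty family of counts the joint law reduces to the law of [go]. *)
have := @joint_law 0%N (fun=> 0%N) (fun=> set0) (fun=> 0%N) `]a, +oo[%classic.
move=> /(_ (measurable_itv _)).
rewrite Rintegral_exp_tail// big_ord0 mulr1 => <-; try by case.
congr (P _); apply/seteqP; split => w; rewrite /= in_itv/= andbT.
  by move=> h; split => // -[].
by case.
Qed.

Lemma measurable_count i A : (1 <= i <= K p)%N -> measurable A ->
  measurable_fun setT (Defs.count (X i) A).
Proof.
move=> iK mA; apply: ge0_emeasurable_sum => [n w _ _|n _].
  by rewrite lee_fin.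
apply/measurable_EFinP; apply: (measurableT_comp _ (mX n iK)).
exact: measurable_indic.
Qed.

Lemma intensity_ge0 (l : R) (rho : R -> R) (A : set ((R * R) * R)) :
  0 <= l -> (forall t, 0 <= rho t) -> (0 <= intensity l rho A)%E.
Proof.
move=> l0 r0; rewrite mule_ge0 ?lee_fin// integral_ge0// => x _.
by rewrite integral_ge0// => y _; rewrite integral_ge0// => t _; rewrite lee_fin mulr_ge0.
Qed.

Lemma mark_density_ge0 i t : 0 <= mark_density p i t.
Proof.
rewrite /mark_density; case: ifP => _.
  rewrite /gamma_density; case: ifP => // t0.
  by rewrite divr_ge0 ?mulr_ge0 ?expR_ge0 ?exprn_ge0.
by rewrite /exp_density; case: ifP => // _; exact: expR_ge0.
Qed.

Lemma count_distribution i A k : (1 <= i <= K p)%N -> measurable A ->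
  (tier_intensity p i A < +oo)%E ->
  P [set w | Defs.count (X i) A w = k%:R%:E] =
  (Defs.poisson_prob (fine (tier_intensity p i A)) k)%:E.
Proof.
move=> iK mA fA.
have := @joint_law 1%N (fun=> i) (fun=> A) (fun=> k) setT measurableT.
rewrite Rintegral_exp_ge0 big_ord1 mul1r => <-//; last first.
  by move=> [[|//] j] [[|//] j'] /eqP /= h; exfalso; apply: h; apply/val_inj.
congr (P _); apply/seteqP; split => w /=.
  by move=> h; split.
by move=> [_ /(_ ord0)]; exact.
Qed.

Hypothesis lam0 : forall i, (1 <= i <= K p)%N -> 0 < lam p i.

Lemma fine_tier_intensity_ge0 i A : (1 <= i <= K p)%N -> 0 <= fine (tier_intensity p i A).
Proof.
move=> iK; apply/fine_ge0/intensity_ge0; first exact/ltW/lam0.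
exact: mark_density_ge0.
Qed.

(** A pair in [L] is a tier with the weight given to each of its points in [A q]. Distinct pairs of
    the same tier have disjoint sets, which is what the joint law asks for, and enumerating [L]
    reduces the claim to [finite_counts_laplace]. *)
Lemma counts_laplace (L : seq (nat * R)) (A : nat * R -> set ((R * R) * R)) (a : R) :
  uniq L -> 0 <= a ->
  (forall q, q \in L -> [/\ (1 <= q.1 <= K p)%N, 0 <= q.2, measurable (A q) &
     (tier_intensity p q.1 (A q) < +oo)%E]) ->
  (forall q q', q \in L -> q' \in L -> q != q' -> q.1 = q'.1 -> A q `&` A q' = set0) ->
  P [set w | (a%:E + \sum_(q <- L) q.2%:E * Defs.count (X q.1) (A q) w < (go w)%:E)%E] =
  (expR (- a) * \prod_(q <- L)
     expR (- (fine (tier_intensity p q.1 (A q)) * (1 - expR (- q.2)))))%:E.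
Proof.
move=> uL a0 LP Ld; set n := size L; pose q0 : nat * R := (0%N, 0).
pose Q j := nth q0 L j.
have QL j : (j < n)%N -> Q j \in L by move=> jn; exact: mem_nth.
(* Past the end of [L] the counts are set to zero, since [finite_counts_laplace] asks for
   measurability at every index. *)
pose N j : Omega -> \bar R := if (j < n)%N then Defs.count (X (Q j).1) (A (Q j)) else cst 0%E.
pose mu j := fine (tier_intensity p (Q j).1 (A (Q j))).
pose c j := (Q j).2.
have E1 w : (\sum_(q <- L) q.2%:E * Defs.count (X q.1) (A q) w =
    \sum_(0 <= j < n) (c j)%:E * N j w)%E.
  rewrite (big_nth q0) !big_nat; apply: eq_bigr => j /= jn.
  by rewrite /N jn.
have E2 : \prod_(q <- L) expR (- (fine (tier_intensity p q.1 (A q)) * (1 - expR (- q.2)))) =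
    \prod_(0 <= j < n) expR (- (mu j * (1 - expR (- c j)))).
  by rewrite (big_nth q0).
rewrite E2; under eq_set do rewrite E1.
apply: finite_counts_laplace => //.
- move=> j; rewrite /N; case: ifP => [jn|_]; last exact: measurable_cst.
  by have [? ? ? _] := LP _ (QL _ jn); exact: measurable_count.
- by move=> j jn; have [? _ _ _] := LP _ (QL _ jn); exact: fine_tier_intensity_ge0.
- move=> j jn; have [jK j0 mj fj] := LP _ (QL _ jn); rewrite /N jn.
  rewrite measure_bigcup//=; last 2 first.
    + move=> k _; rewrite -[X in measurable X]setTI.
      exact: (measurable_count jK mj measurableT (emeasurable_set1 _)).
    + move=> k1 k2 _ _ [w [/= -> /eqP]].
      by rewrite eqe eqr_nat => /eqP.
  rewrite (@eq_eseriesl _ _ xpredT); last by move=> k; rewrite in_setT.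
  (* That the Poisson probabilities have total mass one is the case [a = c = 0] of
     [poisson_laplace]. *)
  transitivity (\sum_(k <oo) (expR (- (0 + 0 * k%:R)) *
      Defs.poisson_prob (mu j) k)%:E)%E.
    apply: eq_eseriesr => k _; rewrite count_distribution//.
    by rewrite mul0r addr0 oppr0 expR0 mul1r.
  rewrite poisson_laplace; last exact: fine_tier_intensity_ge0.
  by rewrite !oppr0 expR0 subrr mulr0 oppr0 expR0 mulr1.
- move=> kk b b0.
  have := @joint_law n (fun j => (Q j).1) (fun j => A (Q j)) (fun j => kk j) `]b, +oo[%classic.
  rewrite Rintegral_exp_tail// => <-; last 5 first.
  + exact: measurable_itv.
  + by move=> j; have [] := LP _ (QL _ (ltn_ord j)).
  + by move=> j; have [] := LP _ (QL _ (ltn_ord j)).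
  + by move=> j; have [] := LP _ (QL _ (ltn_ord j)).
  + move=> j j' jj'; apply: Ld; [exact: QL|exact: QL|].
    by rewrite nth_uniq.
  congr (P _); apply/seteqP; split => w /=; rewrite in_itv/= andbT.
    move=> [h1 h2]; split => // j _ /=.
    by have := h2 j (ltn_ord j); rewrite /N ltn_ord.
  move=> [h1 h2]; split => // j jn; rewrite /N jn.
  exact: (h2 (Ordinal jn)).
- move=> j; rewrite /c; have [jn|jn] := ltnP j n.
    by have [] := LP _ (QL _ jn).
  by rewrite /Q nth_default.
Qed.

End marked_counts.

(** * Laplace transforms of the fading laws *)

Section mark_densities.
Context {R : realType}.
Notation leb := (@lebesgue_measure R).

Lemma gamma_density_ge0 n (t : R) : 0 <= gamma_density n t.
Proof.
rewrite /gamma_density; case: ifP => // t0.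
by rewrite divr_ge0 ?mulr_ge0 ?expR_ge0 ?exprn_ge0.
Qed.

Lemma measurable_gamma_density n : measurable_fun setT (@gamma_density R n).
Proof.
apply: measurable_fun_ifT => //.
- exact: measurable_fun_ler.
- apply: measurable_funM => //; apply: measurable_funM => //.
  by apply: measurableT_comp => //; exact: measurableT_comp.
Qed.

(** Exponential marks are Gamma marks of order one, so that a single computation serves the macro
    tier and the small cells. *)
Lemma exp_densityE : @exp_density R = gamma_density 1.
Proof.
apply/funext => t; rewrite /exp_density /gamma_density/=; case: ifP => // _.
by rewrite expr0 fact0 divr1 mul1r.
Qed.

Lemma integral_exp_gamma_density n (k : R) : (0 < n)%N -> 0 <= k ->
  (\int[leb]_t (expR (- (k * t)) * gamma_density n t)%:E = (((1 + k) ^+ n)^-1)%:E)%E.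
Proof.
case: n => // n _ k0; have k1 : 0 < 1 + k by rewrite ltr_wpDr.
rewrite -integral_gamma// [RHS]integral_mkcond; apply: eq_integral => t _.
rewrite patchE; case: ifPn; rewrite ?notin_setE ?inE/= in_itv/= andbT /gamma_density.
  move=> t0; rewrite t0/=; congr EFin; rewrite mulrDl mul1r opprD expRD; ring.
by move=> /negP/negbTE ->; rewrite mulr0.
Qed.

Lemma integral_gamma_density n : (0 < n)%N ->
  (\int[leb]_t (gamma_density n t)%:E = 1)%E.
Proof.
move=> n0; have := integral_exp_gamma_density n0 (lexx 0).
rewrite addr0 expr1n invr1 => <-; apply: eq_integral => t _.
by rewrite mul0r oppr0 expR0 mul1r.
Qed.

(** Splits the unit mass of the density; the complementary integral is finite, hence can be
    subtracted among extended reals. *)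
Lemma integral_laplace_gamma n (k : R) : (0 < n)%N -> 0 <= k ->
  (\int[leb]_t ((1 - expR (- (k * t))) * gamma_density n t)%:E =
   (1 - ((1 + k) ^+ n)^-1)%:E)%E.
Proof.
move=> n0 k0.
have mE : measurable_fun [set: R] (fun t => expR (- (k * t))).
  by apply: measurableT_comp => //; exact: measurableT_comp.
have mg := measurable_gamma_density n.
have p1 t : 0 <= (1 - expR (- (k * t))) * gamma_density n t.
  have [t0|t0] := ltP t 0.
    by rewrite /gamma_density ifF ?mulr0//; apply/negbTE; rewrite -ltNge.
  by rewrite mulr_ge0 ?gamma_density_ge0// subr_ge0 expR_le1 oppr_le0 mulr_ge0.
have p2 t : 0 <= expR (- (k * t)) * gamma_density n t.
  by rewrite mulr_ge0 ?gamma_density_ge0 ?expR_ge0.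
have := integral_gamma_density n0.
rewrite (eq_integral (fun t : measurableTypeR R => ((1 - expR (- (k * t))) * gamma_density n t)%:E +
    (expR (- (k * t)) * gamma_density n t)%:E)%E); last first.
  by move=> t _; rewrite -EFinD; congr EFin; ring.
rewrite ge0_integralD//=; last 4 first.
- by move=> t _; rewrite lee_fin.
- apply/measurable_EFinP; apply: measurable_funM => //; exact: measurable_funB.
- by move=> t _; rewrite lee_fin.
- by apply/measurable_EFinP; exact: measurable_funM.
rewrite integral_exp_gamma_density// => h.
rewrite EFinB -h addeK//.
Qed.

End mark_densities.

(* The library's canonical sigma-finite structure on [m1 \x m2] is shadowed by the
   one on products of subprobabilities, so it is packed by hand here. *)
Section iterated_tonelli.
Context d1 d2 d3 (T1 : measurableType d1) (T2 : measurableType d2)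
  (T3 : measurableType d3) (R : realType).
Variables (m1 : {sigma_finite_measure set T1 -> \bar R})
  (m2 : {sigma_finite_measure set T2 -> \bar R})
  (m3 : {sigma_finite_measure set T3 -> \bar R}).

Lemma sigma_finite_product_measure1 : sigma_finite setT (m1 \x m2)%E.
Proof.
have /sigma_finiteP[F [TF ndF Foo]] := sigma_finiteT m1.
have /sigma_finiteP[G [TG ndG Goo]] := sigma_finiteT m2.
exists (fun n => F n `*` G n).
  rewrite -setXTT TF TG predeqE => -[x y]; split.
    move=> [/= [n _ Fnx] [k _ Gky]]; exists (maxn n k) => //; split.
    - by move: x Fnx; exact/subsetPset/ndF/leq_maxl.
    - by move: y Gky; exact/subsetPset/ndG/leq_maxr.
  by move=> [n _ []/= ? ?]; split; exists n.
move=> k; have [? ?] := Foo k; have [? ?] := Goo k.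
split; first exact: measurableX.
by rewrite product_measure1E// lte_mul_pinfty// ge0_fin_numE.
Qed.

Let m12 : {sigma_finite_measure set (T1 * T2)%type -> \bar R} :=
  HB.pack (m1 \x m2)%E
    (Measure_isSigmaFinite.Build _ _ _ (m1 \x m2)%E sigma_finite_product_measure1).

Lemma iterated_tonelli (f : (T1 * T2) * T3 -> \bar R) : measurable_fun setT f ->
  (forall z, 0 <= f z)%E ->
  (\int[(m1 \x m2) \x m3]_z f z = \int[m1 \x m2]_y \int[m3]_t f (y, t))%E.
Proof. by move=> mf f0; exact: (@fubini_tonelli1 _ _ _ _ _ m12 m3 f mf f0). Qed.

End iterated_tonelli.

(** * Product measure on positions and marks *)

Section volume.
Context {R : realType}.
Notation leb := (@lebesgue_measure R).

Lemma integral_vol3E (f : (R * R) * R -> \bar R) : measurable_fun setT f ->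
  (forall z, 0 <= f z)%E ->
  (\int[(leb \x leb) \x leb]_z f z = \int[leb \x leb]_y \int[leb]_t f (y, t))%E.
Proof.
move=> mf f0; exact: (@iterated_tonelli _ _ _ (measurableTypeR R) (measurableTypeR R)
  (measurableTypeR R) R leb leb leb f mf f0).
Qed.

(** The iterated integral that defines [intensity] becomes one integral against the product measure,
    to which linearity and monotone convergence apply. *)
Lemma intensityE l (rho : R -> R) A : measurable_fun setT rho ->
  (forall t, 0 <= rho t) -> measurable A ->
  (intensity l rho A = l%:E * \int[(leb \x leb) \x leb]_z (\1_A z * rho z.2)%:E)%E.
Proof.
move=> mr r0 mA; rewrite /intensity; congr (_ * _)%E.
have mf : measurable_fun setT (fun z : (R * R) * R => (\1_A z * rho z.2)%:E).
  apply/measurable_EFinP; apply: measurable_funM; first exact: measurable_indic.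
  exact: measurableT_comp.
have f0 (z : (R * R) * R) : (0 <= (\1_A z * rho z.2)%:E)%E by rewrite lee_fin mulr_ge0.
rewrite integral_vol3E//.
have := @fubini_tonelli1 _ _ (measurableTypeR R) (measurableTypeR R) R leb leb (fun y => \int[leb]_t (\1_A (y, t) * rho t)%:E)%E.
move=> ->//.
- exact: (@measurable_fun_fubini_tonelli_F _ _ (measurableTypeR R * measurableTypeR R)%type (measurableTypeR R) R leb _ mf).
- by move=> y; apply: integral_ge0 => t _; exact: (f0 (y, t)).
Qed.

(** Only positions are bounded: the mark density has mass one, so the intensity of a box is already
    finite. *)
Definition box (n : nat) : set ((R * R) * R) :=
  [set z | (`|z.1.1| <= n%:R) && (`|z.1.2| <= n%:R)].

Lemma measurable_box n : measurable (box n).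
Proof.
have m1 : measurable_fun [set: (R * R) * R] (fun z : (R * R) * R => z.1.1).
  by apply: (measurableT_comp measurable_fst); exact: measurable_fst.
have m2 : measurable_fun [set: (R * R) * R] (fun z : (R * R) * R => z.1.2).
  by apply: (measurableT_comp measurable_snd); exact: measurable_fst.
rewrite /box -[X in measurable X]setTI.
have mb : measurable_fun [set: (R * R) * R] (fun z : (R * R) * R => (`|z.1.1| <= n%:R) && (`|z.1.2| <= n%:R)).
  by apply: measurable_and; apply: measurable_fun_ler => //; exact: measurableT_comp.
exact: (mb measurableT [set true]).
Qed.

Lemma intensity_box_fin (l : R) (rho : R -> R) n : (\int[leb]_t (rho t)%:E = 1)%E ->
  intensity l rho (box n) \is a fin_num.
Proof.
move=> r1; rewrite /intensity.
have I1 (x y : R) : (\int[leb]_t (\1_(box n) ((x, y), t) * rho t)%:E =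
    (\1_`[(- n%:R), n%:R] x * \1_`[(- n%:R), n%:R] y)%:E)%E.
  have b t : (\1_(box n) ((x, y), t) : R) = \1_`[(- n%:R), n%:R] x * \1_`[(- n%:R), n%:R] y.
    rewrite !indicE -natrM mulnb; congr (nat_of_bool _)%:R.
    apply/idP/idP.
      rewrite inE /box/= => /andP[h1 h2]; apply/andP.
      by split; rewrite inE/= in_itv/= -ler_norml.
    move=> /andP[]; rewrite !inE/= !in_itv/= -!ler_norml => h1 h2.
    by rewrite /box/= h1 h2.
  under eq_integral do rewrite b.
  rewrite !indicE; case: (x \in _); case: (y \in _) => /=;
    rewrite ?mulr0n ?mulr1n ?mulr1 ?mulr0 ?mul0r; last 3 first.
  - by rewrite integral0_eq// => t _; rewrite mul0r.
  - by rewrite integral0_eq// => t _; rewrite mul0r.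
  - by rewrite integral0_eq// => t _; rewrite mul0r.
  by under eq_integral do rewrite mul1r.
have m0 : (lebesgue_measure (`[(- n%:R)%R, n%:R]%classic : set R) \is a fin_num)%E.
  by rewrite lebesgue_measure_itv/=; case: ifP.
have mI : measurable_fun [set: measurableTypeR R]
    (fun y : measurableTypeR R => ((\1_`[(- n%:R), n%:R] y : R)%:E)).
  by apply/measurable_EFinP; exact: measurable_indic.
under eq_integral do under eq_integral do rewrite I1 EFinM.
under eq_integral.
  move=> x _; rewrite ge0_integralZl; [|by []|exact: mI|by move=> y _; rewrite lee_fin|].
  rewrite integral_indic// setIT. over.
  by rewrite lee_fin.
rewrite ge0_integralZr; [|by []|exact: mI|by move=> y _; rewrite lee_fin|exact: measure_ge0].
by rewrite integral_indic// setIT !fin_numM.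
Qed.

Lemma measurable_norm2 : measurable_fun [set: R * R] (@norm2 R).
Proof.
rewrite /norm2; apply: (@measurableT_comp _ _ _ _ _ _ (@Num.sqrt R)); last exact: measurable_rad2.
exact: (continuous_measurable_fun (@sqrt_continuous R)).
Qed.

End volume.

(** * Laplace transform of the shot noise *)

Lemma cvgn_sum (R : realType) (I : eqType) (r : seq I) (f : I -> nat -> R) (l : I -> R) :
  (forall i, i \in r -> f i n @[n --> \oo] --> l i) ->
  \sum_(i <- r) f i n @[n --> \oo] --> \sum_(i <- r) l i.
Proof.
elim: r => [|i r IH] fl.
  by under eq_fun do rewrite big_nil; rewrite big_nil; exact: cvg_cst.
under eq_fun do rewrite big_cons; rewrite big_cons; apply: cvgD.
  by apply: fl; rewrite mem_head.
by apply: IH => j jr; apply: fl; rewrite in_cons jr orbT.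
Qed.

Lemma cvg_expR_seq (R : realType) (u : nat -> R) (l : R) :
  u n @[n --> \oo] --> l -> expR (u n) @[n --> \oo] --> expR l.
Proof. by move=> h; apply: (cvg_comp _ _ h); exact: continuous_expR. Qed.

Section ppp_laplace.
Context {R : realType} (p : hetnet_params R) {d : measure_display}
  {Omega : measurableType d} (P : probability Omega R)
  (X : nat -> Omega -> nat -> (R * R) * R) (go : Omega -> R).
Hypothesis law : hetnet_law p P X go.
Hypothesis lam0 : forall i, (1 <= i <= K p)%N -> 0 < lam p i.
Hypothesis N0 : (0 < N p)%N.
Notation leb := (@lebesgue_measure R).
Notation vol := ((leb \x leb) \x leb)%E.
Notation T := ((R * R) * R)%type.

Definition mark_order (p : hetnet_params R) i := if i == 1%N then N p else 1%N.

Lemma mark_densityE i : mark_density p i = gamma_density (mark_order p i).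
Proof. by rewrite /mark_density /mark_order exp_densityE; case: ifP. Qed.

Lemma mark_order_gt0 i : (0 < mark_order p i)%N.
Proof. by rewrite /mark_order; case: ifP. Qed.

Lemma measurable_mark_density i : measurable_fun setT (mark_density p i).
Proof. by rewrite mark_densityE; exact: measurable_gamma_density. Qed.

Lemma measurable_mark_density2 i :
  measurable_fun setT (fun z : T => mark_density p i z.2).
Proof. exact: (measurableT_comp (measurable_mark_density i)). Qed.

Lemma tier_intensityE i A : measurable A ->
  (tier_intensity p i A = (lam p i)%:E * \int[vol]_z (\1_A z * mark_density p i z.2)%:E)%E.
Proof.
move=> mA; apply: intensityE => //; first exact: measurable_mark_density.
exact: mark_density_ge0.
Qed.

(** Minus the logarithm of the Laplace functional of the marked Poisson process of tier [i] at
    [g]. *)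
Definition laplace_exponent i (g : T -> R) : \bar R :=
  ((lam p i)%:E * \int[vol]_z ((1 - expR (- g z)) * mark_density p i z.2)%:E)%E.

Let mexp (g : T -> R) : measurable_fun setT g ->
  measurable_fun setT (fun z => 1 - expR (- g z)).
Proof.
move=> mg; apply: measurable_funB => //; apply: measurableT_comp => //.
exact: measurableT_comp.
Qed.

Let oneBexp_ge0 (x : R) : 0 <= x -> 0 <= 1 - expR (- x).
Proof. by move=> x0; rewrite subr_ge0 expR_le1 oppr_le0. Qed.

Let mintegrand i (g : T -> R) : measurable_fun setT g ->
  measurable_fun setT (fun z : T => ((1 - expR (- g z)) * mark_density p i z.2)%:E).
Proof.
move=> mg; apply/measurable_EFinP; apply: measurable_funM; first exact: mexp.
exact: measurable_mark_density2.
Qed.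

Lemma le_laplace_exponent i (g h : T -> R) : (1 <= i <= K p)%N ->
  measurable_fun setT g -> measurable_fun setT h ->
  (forall z, 0 <= g z) -> (forall z, g z <= h z) ->
  (laplace_exponent i g <= laplace_exponent i h)%E.
Proof.
move=> iK mg mh g0 gh; apply: lee_wpmul2l; first by rewrite lee_fin ltW// lam0.
apply: ge0_le_integral => //.
- by move=> z _; rewrite lee_fin mulr_ge0 ?mark_density_ge0 ?oneBexp_ge0.
- exact: mintegrand.
- exact: mintegrand.
- move=> z _; rewrite lee_fin ler_wpM2r ?mark_density_ge0//.
  by rewrite lerB// ler_expR lerN2.
Qed.

(** The difference of the two sides is at least [(c - 1) * (1 - (1 + x) * expR (- x))], which is
    nonnegative because [1 + x <= expR x]. *)
Lemma oneBexp_concave (c x : R) : 1 <= c -> 0 <= x ->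
  1 - expR (- (c * x)) <= c * (1 - expR (- x)).
Proof.
move=> c1 x0.
have h1 : expR (- x) * (1 - (c - 1) * x) <= expR (- (c * x)).
  rewrite (_ : - (c * x) = - x + - ((c - 1) * x)); last by ring.
  by rewrite expRD ler_pM2l ?expR_gt0// expR_ge1Dx.
have h2 : (1 + x) * expR (- x) <= 1.
  by rewrite expRN ler_pdivrMr ?expR_gt0// mul1r expR_ge1Dx.
have h3 : 0 <= (c - 1) * (1 - (1 + x) * expR (- x)) by rewrite mulr_ge0; lra.
by move: h1 h3; set e := expR (- x); set f := expR _; nra.
Qed.

Lemma laplace_exponent_scale i (c : R) (g : T -> R) : (1 <= i <= K p)%N -> 1 <= c ->
  measurable_fun setT g -> (forall z, 0 <= g z) ->
  (laplace_exponent i (fun z => c * g z)%R <= c%:E * laplace_exponent i g)%E.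
Proof.
move=> iK c1 mg g0; have c0 : 0 <= c by rewrite (le_trans _ c1).
rewrite /laplace_exponent muleCA; apply: lee_wpmul2l; first by rewrite lee_fin ltW// lam0.
have mcg : measurable_fun setT (fun z => c * g z) by exact: measurable_funM.
rewrite -ge0_integralZl; [|by []|exact: (mintegrand i mg)| |by rewrite lee_fin]; last first.
  by move=> z _; rewrite lee_fin mulr_ge0 ?mark_density_ge0 ?oneBexp_ge0.
apply: ge0_le_integral => //.
- by move=> z _; rewrite lee_fin mulr_ge0 ?mark_density_ge0 ?oneBexp_ge0 ?mulr_ge0.
- exact: (mintegrand i mcg).
- by apply: measurable_funeM; exact: mintegrand.
- move=> z _; rewrite -EFinM lee_fin mulrA ler_wpM2r ?mark_density_ge0//.
  exact: oneBexp_concave.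
Qed.

(** The enumeration index is outermost: the superposed tiers form one series, whose finite partial
    sums carry the limit argument of [stage_shot_le]. *)
Definition shot (g : nat -> T -> R) (w : Omega) : \bar R :=
  (\sum_(n <oo) \sum_(1 <= i < (K p).+1) (g i (X i w n))%:E)%E.

Lemma measurable_shot (g : nat -> T -> R) : (forall i, measurable_fun setT (g i)) ->
  (forall i z, 0 <= g i z) -> measurable_fun setT (shot g).
Proof.
move=> mg g0; apply: ge0_emeasurable_sum => [n w _ _|n _].
  by apply: sume_ge0 => i _; rewrite lee_fin.
rewrite (_ : (fun w => _) = (fun w => \sum_(1 <= i < (K p).+1)
    (if (1 <= i <= K p)%N then (g i (X i w n))%:E else 0))%E); last first.
  by apply/funext => w; rewrite !big_nat; apply: eq_bigr => i; rewrite ltnS => ->.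
apply: emeasurable_sum => i; have [iK|iK] := boolP (1 <= i <= K p)%N; last exact: measurable_cst.
apply/measurable_EFinP; apply: (measurableT_comp (mg i)).
exact: (proj1 law).
Qed.

Lemma measurable_shot_event (g : nat -> T -> R) (a : R) : (forall i, measurable_fun setT (g i)) ->
  (forall i z, 0 <= g i z) -> measurable [set w | (a%:E + shot g w < (go w)%:E)%E].
Proof.
move=> mg g0; rewrite -[X in measurable X]setTI; apply: measurable_lte => //.
  by apply: emeasurable_funD => //; exact: measurable_shot.
by apply/measurable_EFinP; case: law => _ [].
Qed.

Lemma shot_ge0 (g : nat -> T -> R) w : (forall i z, 0 <= g i z) -> (0 <= shot g w)%E.
Proof. by move=> g0; apply: nneseries_ge0 => n _ _; apply: sume_ge0 => i _; rewrite lee_fin. Qed.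

Lemma le_shot (g h : nat -> T -> R) w : (forall i z, 0 <= g i z) -> (forall i z, g i z <= h i z) ->
  (shot g w <= shot h w)%E.
Proof.
move=> g0 gh; apply: lee_nneseries => [n _ _|n _]; first by apply: sume_ge0 => i _; rewrite lee_fin.
by apply: lee_sum => i _; rewrite lee_fin.
Qed.

(** * Simple functions of bounded support *)

Section simple.
Import HBNNSimple.
Variables (h : nat -> {nnsfun T >-> R}) (m : nat).

Definition boxed (i : nat) (z : T) : R := h i z * \1_(box m) z.

(** Level sets of the simple function of tier [q.1]: for distinct values they are disjoint, and the
    box keeps their intensity finite, including that of the level zero. *)
Let A (q : nat * R) : set T := h q.1 @^-1` [set q.2] `&` box m.

Let L := [seq (i, r) | i <- index_iota 1 (K p).+1, r <- fset_set (range (h i))].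

Let mA q : measurable (A q).
Proof. by apply: measurableI; [exact: measurable_sfunP|exact: measurable_box]. Qed.

(** Outside the box both sides vanish because [u 0 = 0]. It is used with the identity for the shot
    noise and with [1 - expR (- x)] for the Laplace exponent. *)
Let level_sum i (u : R -> R) z : u 0 = 0 ->
  u (boxed i z) = \sum_(r <- fset_set (range (h i))) u r * \1_(A (i, r)) z.
Proof.
move=> u0; rewrite (bigD1_seq (h i z)) ?fset_uniq//=; last first.
  by rewrite in_fset_set ?inE//; exists z.
rewrite big1 ?addr0 => [|r rz]; last first.
  rewrite indicE memNset ?mulr0// => -[/= hz _].
  by move: rz; rewrite hz eqxx.
rewrite /boxed !indicE.
have [zb|zb] := boolP (z \in box m).
  by rewrite mem_set ?mulr1//; split => //; rewrite inE in zb.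
by rewrite memNset ?mulr0 ?u0// => -[_ /mem_set]; rewrite (negbTE zb).
Qed.

Let uniq_L : uniq L.
Proof.
apply: allpairs_uniq_dep => //; first exact: iota_uniq.
by move=> [i r] [j s] _ _ /= [-> ->].
Qed.

Let range_ge0 i r : r \in fset_set (range (h i)) -> 0 <= r.
Proof. by rewrite in_fset_set// inE => -[z _ <-]; exact: fun_ge0. Qed.

Let LP q : q \in L -> (1 <= q.1 <= K p)%N /\ 0 <= q.2.
Proof.
move=> /allpairsPdep[i [r [iK rh ->]]] /=; split.
  by move: iK; rewrite mem_index_iota ltnS.
exact: range_ge0 rh.
Qed.

Let fin_tier q : (1 <= q.1 <= K p)%N -> (tier_intensity p q.1 (A q) < +oo)%E.
Proof.
move=> qK; apply: (@le_lt_trans _ _ (tier_intensity p q.1 (box m))); last first.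
  rewrite ltey_eq; apply/orP; left; apply: intensity_box_fin.
  by rewrite mark_densityE integral_gamma_density// mark_order_gt0.
rewrite !tier_intensityE//; last exact: measurable_box.
apply: lee_wpmul2l; first by rewrite lee_fin ltW// lam0.
have mI (B : set T) : measurable B ->
    measurable_fun setT (fun z : T => (\1_B z * mark_density p q.1 z.2)%:E).
  move=> mB; apply/measurable_EFinP; apply: measurable_funM.
    exact: measurable_indic.
  exact: measurable_mark_density2.
apply: ge0_le_integral => //.
- by move=> z _; rewrite lee_fin mulr_ge0 ?mark_density_ge0.
- exact: mI.
- exact: mI (measurable_box m).
- move=> z _; rewrite lee_fin ler_wpM2r ?mark_density_ge0//.
  by rewrite !indicE ler_nat; case: (boolP (z \in A q)) => //; rewrite inE => -[_ /mem_set ->].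
Qed.

Lemma measurable_boxed i : measurable_fun setT (boxed i).
Proof.
by apply: measurable_funM => //; exact: measurable_indic (measurable_box m).
Qed.

Lemma boxed_ge0 i z : 0 <= boxed i z.
Proof. by rewrite mulr_ge0//; exact: fun_ge0. Qed.

Let sum_counts w : (\sum_(q <- L) q.2%:E * Defs.count (X q.1) (A q) w = shot boxed w)%E.
Proof.
rewrite big_allpairs_dep/= /shot nneseries_sum_nat; last first.
  by move=> i j; rewrite lee_fin boxed_ge0.
apply: eq_bigr => i _.
transitivity (\sum_(r <- fset_set (range (h i))) \sum_(n <oo)
    (r * \1_(A (i, r)) (X i w n))%:E)%E.
  rewrite !big_seq; apply: eq_bigr => r rh; by rewrite -nneseriesZl.
rewrite big_seq -nneseries_sum; last first.
  by move=> r n rh; rewrite lee_fin mulr_ge0// (range_ge0 rh).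
by apply: eq_eseriesr => n _; rewrite -big_seq sumEFin (level_sum i (u := id)).
Qed.

Let exponentE i : (1 <= i <= K p)%N ->
  (laplace_exponent i (boxed i) = \sum_(r <- fset_set (range (h i)))
    (fine (tier_intensity p i (A (i, r))) * (1 - expR (- r)))%:E)%E.
Proof.
move=> iK; rewrite /laplace_exponent.
have mI r : measurable_fun setT (fun z : T => (\1_(A (i, r)) z * mark_density p i z.2)%:E).
  apply/measurable_EFinP; apply: measurable_funM; first exact: measurable_indic.
  exact: measurable_mark_density2.
have I0 r z : (0 <= (\1_(A (i, r)) z * mark_density p i z.2)%:E)%E.
  by rewrite lee_fin mulr_ge0 ?mark_density_ge0.
(* The absolute value changes nothing on the nonnegative range of [h i], and makes the terms
   nonnegative for every [r], as exchanging sum and integral requires. *)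
have E0 (r : R) : (0 <= (1 - expR (- `|r|))%:E)%E by rewrite lee_fin oneBexp_ge0.
transitivity ((lam p i)%:E * \int[vol]_z \sum_(r <- fset_set (range (h i)))
    ((1 - expR (- `|r|))%:E * (\1_(A (i, r)) z * mark_density p i z.2)%:E))%E.
  congr (_ * _)%E; apply: eq_integral => z _.
  rewrite (level_sum i (u := fun x => 1 - expR (- x))); last by rewrite oppr0 expR0 subrr.
  rewrite mulr_suml -sumEFin !big_seq; apply: eq_bigr => r rh.
  by rewrite -EFinM mulrA ger0_norm// (range_ge0 rh).
rewrite ge0_integral_sum//; last 2 first.
- by move=> r; apply: measurable_funeM; exact: mI.
- by move=> r z _; rewrite mule_ge0.
rewrite ge0_sume_distrr; last first.
  by move=> r _; apply: integral_ge0 => z _; rewrite mule_ge0.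
rewrite !big_seq; apply: eq_bigr => r rh.
rewrite ge0_integralZl//; last exact: mI.
rewrite muleCA -tier_intensityE// EFinM fineK; last first.
  rewrite ge0_fin_numE; first exact: (@fin_tier (i, r) iK).
  by apply: intensity_ge0; [exact/ltW/lam0|exact: mark_density_ge0].
by rewrite muleC ger0_norm// (range_ge0 rh).
Qed.

Lemma laplace_exponent_boxed_fin i : (1 <= i <= K p)%N ->
  laplace_exponent i (boxed i) \is a fin_num.
Proof. by move=> iK; rewrite exponentE// sumEFin. Qed.

Lemma boxed_laplace (a : R) : 0 <= a ->
  P [set w | (a%:E + shot boxed w < (go w)%:E)%E] =
  (expR (- (a + \sum_(1 <= i < (K p).+1) fine (laplace_exponent i (boxed i)))))%:E.
Proof.
move=> a0; under eq_set do rewrite -sum_counts.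
have LP' q : q \in L -> [/\ (1 <= q.1 <= K p)%N, 0 <= q.2, measurable (A q) &
    (tier_intensity p q.1 (A q) < +oo)%E].
  by move=> /LP[? ?]; split => //; exact: fin_tier.
have Ld q q' : q \in L -> q' \in L -> q != q' -> q.1 = q'.1 -> A q `&` A q' = set0.
  case: q q' => [i r] [j s] _ _ /= rs ij.
  apply/seteqP; split => // z [[/= hr _] [/= hs _]].
  by move: rs; rewrite ij -hr -hs ij eqxx.
rewrite (counts_laplace law lam0 uniq_L a0 LP' Ld).
rewrite big_allpairs_dep/= opprD expRD; congr (_ * _)%:E.
rewrite -sumrN expR_sum !big_nat; apply: eq_bigr => i iK.
by rewrite exponentE// sumEFin/= -sumrN expR_sum.
Qed.

End simple.

(** * Monotone approximation of a general function *)

Section approximation.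
Import HBNNSimple.
Variable g : nat -> T -> R.
Hypothesis mg : forall i, measurable_fun setT (g i).
Hypothesis g0 : forall i z, 0 <= g i z.

Let meg i : measurable_fun setT (EFin \o g i).
Proof. exact/measurable_EFinP. Qed.

(** The box widens together with the accuracy of the simple function, so that the stages increase to
    [g i] everywhere while each keeps a bounded support in position. *)
Definition stage (n : nat) : nat -> T -> R :=
  boxed (fun i => nnsfun_approx measurableT (meg i) n) n.

Lemma stage_le n i z : stage n i z <= g i z.
Proof.
rewrite /stage /boxed.
have : (nnsfun_approx measurableT (meg i) n : T -> R) z <= g i z.
  rewrite nnsfun_approxE -lee_fin; apply: le_approx => //.
  by move=> x _; rewrite /= lee_fin.
have : 0 <= (nnsfun_approx measurableT (meg i) n : T -> R) z by exact: fun_ge0.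
by rewrite indicE; case: (z \in _) => /=; rewrite ?mulr1 ?mulr0// => ? ?; exact: g0.
Qed.

Lemma stage_nd i z m n : (m <= n)%N -> stage m i z <= stage n i z.
Proof.
move=> mn; rewrite /stage /boxed; apply: ler_pM; [exact: fun_ge0|by rewrite indicE|exact/lefP/nd_nnsfun_approx|].
  rewrite !indicE ler_nat.
  case: (boolP (z \in box m)) => //; rewrite inE /box/= => /andP[h1 h2].
  have mnR : m%:R <= n%:R :> R by rewrite ler_nat.
  by rewrite mem_set//= (le_trans h1 mnR) (le_trans h2 mnR).
Qed.

Lemma stage_cvg i z : stage n i z @[n --> \oo] --> g i z.
Proof.
have : EFin \o (fun n => nnsfun_approx measurableT (meg i) n z) @ \oo --> (g i z)%:E.
  by apply: cvg_nnsfun_approx => // x _; rewrite /= lee_fin.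
move=> /fine_cvgP[_]; apply: cvg_trans; apply: near_eq_cvg.
near=> n; rewrite /stage /boxed/= indicE mem_set ?mulr1//= /box/=.
by apply/andP; split; near: n; exact: nbhs_infty_ger.
Unshelve. all: by end_near. Qed.

Lemma measurable_stage n i : measurable_fun setT (stage n i).
Proof. exact: measurable_boxed. Qed.

Lemma stage_ge0 n i z : 0 <= stage n i z.
Proof. exact: boxed_ge0. Qed.

Lemma stage_laplace n (a : R) : 0 <= a ->
  P [set w | (a%:E + shot (stage n) w < (go w)%:E)%E] =
  (expR (- (a + \sum_(1 <= i < (K p).+1) fine (laplace_exponent i (stage n i)))))%:E.
Proof. exact: boxed_laplace. Qed.

(** Monotone convergence, as [1 - expR (- x)] is increasing and continuous in [x]. *)
Lemma laplace_exponent_stage_cvg i :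
  laplace_exponent i (stage n i) @[n --> \oo] --> laplace_exponent i (g i).
Proof.
apply: cvgeZl => //.
have := @cvg_monotone_convergence _ _ R vol setT measurableT
  (fun n (z : T) => ((1 - expR (- stage n i z)) * mark_density p i z.2)%:E).
rewrite (_ : (fun z => limn _) =
    (fun z : T => ((1 - expR (- g i z)) * mark_density p i z.2)%:E)); last first.
  apply/funext => z; apply/cvg_lim => //; apply: cvg_EFin; first exact: nearW.
  apply: cvgM; last exact: cvg_cst.
  apply: cvgB; first exact: cvg_cst.
  apply: continuous_cvg; first exact: continuous_expR.
  by apply: cvgN; exact: stage_cvg.
apply.
- by move=> n; apply: mintegrand; exact: measurable_stage.
- by move=> n z _; rewrite lee_fin mulr_ge0 ?mark_density_ge0 ?oneBexp_ge0 ?stage_ge0.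
- move=> z _ m n mn; rewrite lee_fin ler_wpM2r ?mark_density_ge0//.
  by rewrite lerB// ler_expR lerN2 stage_nd.
Qed.

(** A bound uniform in [n] passes to the limit on each finite partial sum over points, where the
    stages converge termwise, and then to the whole series. *)
Lemma stage_shot_le w (b : \bar R) : (forall n, shot (stage n) w <= b)%E -> (shot g w <= b)%E.
Proof.
move=> h; apply: lime_le.
  by apply: is_cvg_nneseries => n _ _; apply: sume_ge0 => i _; rewrite lee_fin.
apply: nearW => m.
have cv : (\sum_(0 <= k < m) \sum_(1 <= i < (K p).+1) stage n i (X i w k)) @[n --> \oo]
    --> \sum_(0 <= k < m) \sum_(1 <= i < (K p).+1) g i (X i w k).
  by apply: cvgn_sum => k _; apply: cvgn_sum => i _; exact: stage_cvg.
have cvE : (\sum_(0 <= k < m) \sum_(1 <= i < (K p).+1) stage n i (X i w k))%:E @[n --> \oo]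
    --> (\sum_(0 <= k < m) \sum_(1 <= i < (K p).+1) g i (X i w k))%:E.
  by apply: cvg_EFin => //; exact: nearW.
apply: (@le_trans _ _ (limn (fun n =>
    (\sum_(0 <= k < m) \sum_(1 <= i < (K p).+1) stage n i (X i w k))%:E))).
  rewrite (cvg_lim _ cvE)// -sumEFin; apply: lee_sum => k _.
  by rewrite -sumEFin.
apply: lime_le; first by apply/cvg_ex; eexists; exact: cvE.
apply: nearW => n; apply: le_trans (h n).
rewrite /= -sumEFin; apply: le_trans (nneseries_lim_ge m _) => [|k _ _].
  by rewrite le_eqVlt; apply/orP; left; apply/eqP; apply: eq_bigr => k _; rewrite sumEFin.
by apply: sume_ge0 => i _; rewrite lee_fin stage_ge0.
Qed.

End approximation.

Lemma shot_scale (c : R) (g : nat -> T -> R) w : 0 <= c -> (forall i z, 0 <= g i z) ->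
  (shot (fun i z => c * g i z)%R w = c%:E * shot g w)%E.
Proof.
move=> c0 g0; rewrite /shot -nneseriesZl; last first.
  by move=> n _; apply: sume_ge0 => i _; rewrite lee_fin.
by apply: eq_eseriesr => n _; rewrite !sumEFin -EFinM mulr_sumr.
Qed.

Lemma ppp_laplace_transform (g : nat -> T -> R) (a : R) (phi : nat -> R) :
  (forall i, measurable_fun setT (g i)) -> (forall i z, 0 <= g i z) -> 0 <= a ->
  (forall i, (1 <= i <= K p)%N -> laplace_exponent i (g i) = (phi i)%:E) ->
  P [set w | (a%:E + shot g w < (go w)%:E)%E] =
  (expR (- (a + \sum_(1 <= i < (K p).+1) phi i)))%:E.
Proof.
move=> mg g0 a0 gphi; set E := [set w | _]; set s := \sum_(1 <= i < _) phi i.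
have mE : measurable E by exact: measurable_shot_event.
apply/eqP; rewrite eq_le; apply/andP; split.
  pose u n := expR (- (a + \sum_(1 <= i < (K p).+1) fine (laplace_exponent i (stage mg n i)))).
  have cv : u n @[n --> \oo] --> expR (- (a + s)).
    apply: cvg_expR_seq.
    apply: cvgN; apply: cvgD; first exact: cvg_cst.
    apply: cvgn_sum => i; rewrite mem_index_iota ltnS => iK.
    by have := laplace_exponent_stage_cvg mg g0 (i := i); rewrite gphi// => /fine_cvgP[_].
  have cvE : (u n)%:E @[n --> \oo] --> (expR (- (a + s)))%:E.
    by apply: cvg_EFin => //; exact: nearW.
  apply: (@le_trans _ _ (limn (fun n => (u n)%:E))); last by rewrite (cvg_lim _ cvE).
  apply: lime_ge; first by apply/cvg_ex; eexists; exact: cvE.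
  apply: nearW => n; rewrite /u -stage_laplace//; apply: le_measure; rewrite ?inE//.
    by apply: measurable_shot_event; [exact: measurable_stage|exact: stage_ge0].
  move=> w; rewrite /E/=; apply: le_lt_trans; apply: leeD2l.
  by apply: le_shot; [exact: stage_ge0|exact: stage_le].
(* The lower bound is first proved with a loss factor [c], which is removed at the end along
   [1 + n.+1%:R^-1]. *)
have lower c : 1 < c -> ((expR (- (c * (a + s))))%:E <= P E)%E.
  move=> c1; have c0 : 0 <= c by rewrite ltW// (lt_trans _ c1).
  pose cg i z := c * g i z.
  have mcg i : measurable_fun setT (cg i) by exact: measurable_funM.
  have cg0 i z : 0 <= cg i z by rewrite mulr_ge0.
  pose B n := [set w | ((c * a)%:E + shot (stage mcg n) w < (go w)%:E)%E].
  have mB n : measurable (B n).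
    by apply: measurable_shot_event; [exact: measurable_stage|exact: stage_ge0].
  have mcap : measurable (\bigcap_n B n) by exact: bigcapT_measurable.
  have mgo : measurable [set w | 0 < go w].
    rewrite -[X in measurable X]setTI.
    have := proj1 (proj2 law) measurableT _ (measurable_itv `]0, +oo[).
    by congr measurable; apply/seteqP; split => w /=; rewrite in_itv/= andbT.
  have Pgo : P [set w | 0 < go w] = 1%E.
    by rewrite (tail_serving_fading law)// oppr0 expR0.
  (* In the limit over [n] only the weak inequality between [c * (a + shot g w)] and [go w]
     survives. It rules out an infinite shot, and [1 < c] with [0 < go w] restores strictness even
     when [a + shot g w] is zero. *)
  have BE : \bigcap_n B n `&` [set w | 0 < go w] `<=` E.
    move=> w [hB /= go0].
    have : (shot cg w <= (go w - c * a)%:E)%E.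
      apply: (@stage_shot_le _ mcg cg0) => n; have := hB n Logic.I; rewrite /B/= => /ltW.
      by rewrite addeC -leeBrDr// EFinB.
    rewrite /cg shot_scale// /E/=.
    have := shot_ge0 w g0; case: (shot g w) => [z| |]//.
      by rewrite -EFinM -EFinD !lee_fin lte_fin => z0 h; nra.
    by rewrite mulry gtr0_sg ?mul1e// (lt_trans _ c1).
  (* The exponent of a stage of [c * g] is at most that of [c * g], hence at most [c * phi i] by
     [laplace_exponent_scale]. *)
  have PB n : ((expR (- (c * (a + s))))%:E <= P (B n))%E.
    rewrite (stage_laplace mcg)// ?mulr_ge0// lee_fin ler_expR lerN2 mulrDr lerD2l.
    rewrite mulr_sumr !big_nat; apply: ler_sum => i; rewrite ltnS => iK.
    have mst := measurable_stage mcg n i; have st0 := stage_ge0 mcg n i.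
    rewrite -lee_fin fineK; last exact: laplace_exponent_boxed_fin.
    apply: (le_trans (le_laplace_exponent iK mst (mcg i) st0 (stage_le mcg cg0 n i))).
    by rewrite EFinM -gphi//; apply: laplace_exponent_scale => //; exact: ltW.
  apply: (@le_trans _ _ (P (\bigcap_n B n))).
    have cvB : P (B n) @[n --> \oo] --> P (\bigcap_n B n).
      apply: nonincreasing_cvg_mu => //.
        by rewrite (le_lt_trans (probability_le1 _ _)) ?ltry.
      move=> m n mn; apply/subsetPset => w; rewrite /B/=; apply: le_lt_trans; apply: leeD2l.
      by apply: le_shot; [exact: stage_ge0|move=> i z; exact: stage_nd].
    rewrite -(cvg_lim _ cvB)//; apply: lime_ge; first by apply/cvg_ex; eexists; exact: cvB.
    exact: nearW.
  rewrite (probability_setI1 mcap mgo Pgo); apply: le_measure; rewrite ?inE//.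
  exact: measurableI.
have cv : expR (- ((1 + n.+1%:R^-1) * (a + s))) @[n --> \oo] --> expR (- (a + s)).
  apply: cvg_expR_seq.
  rewrite -[X in _ --> - X]mul1r; apply: cvgN; apply: cvgM; last exact: cvg_cst.
  rewrite -[X in _ --> X]addr0; apply: cvgD; first exact: cvg_cst.
  exact: cvg_harmonic.
have cvE : (expR (- ((1 + n.+1%:R^-1) * (a + s))))%:E @[n --> \oo] --> (expR (- (a + s)))%:E.
  by apply: cvg_EFin => //; exact: nearW.
rewrite -(cvg_lim _ cvE)//; apply: lime_le; first by apply/cvg_ex; eexists; exact: cvE.
by apply: nearW => n; apply: lower; rewrite ltrDl invr_gt0.
Qed.

End ppp_laplace.

(** * Power substitution *)

Section power_substitution.
Context {R : realType}.
Notation leb := (@lebesgue_measure R).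

Lemma continuous_powR_gt0 (e x : R) : 0 < x -> {for x, continuous (fun t : R => t `^ e)}.
Proof.
move=> x0; apply/differentiable_continuous/derivable1_diffP.
exact: (@ex_derive _ _ _ _ _ _ _ (is_derive1_powR e x0)).
Qed.

Lemma eq_gt0_continuous (f g : R -> R) (x : R) : 0 < x ->
  {in `]0, +oo[, f =1 g} -> {for x, continuous g} -> {for x, continuous f}.
Proof.
move=> x0 fg cg; rewrite /prop_for /continuous_at fg ?in_itv/= ?x0//.
apply: cvg_trans cg; apply: near_eq_cvg; near=> z.
by rewrite fg// in_itv/= andbT; near: z; exact: lt_nbhsr.
Unshelve. all: by end_near. Qed.

Lemma within_continuous_gt0 (f : R -> R) (a b : R) : 0 < a ->
  {in `]0, +oo[, forall x, {for x, continuous f}} -> {within `[a, b], continuous f}.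
Proof.
move=> a0 cf; apply: continuous_in_subspaceT => x; rewrite inE/= in_itv/= => /andP[ax _].
by apply: cf; rewrite in_itv/= andbT (lt_le_trans a0).
Qed.

(** These closed intervals avoid zero, where negative powers are singular. The fundamental theorem
    and the substitution rule are applied on each of them, followed by a monotone limit. *)
Lemma bigcup_itv_shrink (k : R) : 0 < k ->
  \bigcup_n `[k / n.+1%:R, k]%classic = `]0, k]%classic.
Proof.
move=> k0; apply/seteqP; split => x /=.
  move=> [n _]; rewrite /= !in_itv/= => /andP[h ->]; rewrite andbT.
  by apply: lt_le_trans h; rewrite divr_gt0.
rewrite in_itv/= => /andP[x0 xk]; exists (Num.trunc (k / x)) => //=.
rewrite in_itv/= xk andbT ler_pdivrMr// mulrC -ler_pdivrMr//.
exact/ltW/truncnS_gt.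
Qed.

Lemma shrink_nd (k : R) : 0 < k ->
  nondecreasing_seq (fun n : nat => `[k / n.+1%:R, k]%classic).
Proof.
move=> k0 m n mn; apply/subsetPset => x /=; rewrite !in_itv/= => /andP[h ->].
rewrite andbT; apply: le_trans h; rewrite ler_pM2l// lef_pV2 ?posrE//.
by rewrite ler_nat ltnS.
Qed.

Lemma cvg_shrink (k : R) : k / n.+1%:R @[n --> \oo] --> (0 : R).
Proof.
rewrite -[X in _ --> X](mulr0 k); apply: cvgM; first exact: cvg_cst.
exact: cvg_harmonic.
Qed.

Lemma cvg_shrink_integral (k : R) (f : R -> \bar R) : 0 < k ->
  measurable_fun `]0, k] f -> (forall x : R, 0 < x -> (0 <= f x)%E) ->
  (\int[leb]_(x in `[(k / n.+1%:R)%R, k]) f x @[n --> \oo] -->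
   \int[leb]_(x in `]0%R, k]) f x)%E.
Proof.
move=> k0 mf f0; rewrite -bigcup_itv_shrink//.
apply: ge0_nondecreasing_set_cvg_integral.
- exact: shrink_nd.
- by move=> n; exact: measurable_itv.
- move=> n; apply: (measurable_funS _ _ mf) => //.
  move=> x /=; rewrite !in_itv/= => /andP[h ->]; rewrite andbT.
  by apply: lt_le_trans h; rewrite divr_gt0.
- move=> n x /=; rewrite in_itv/= => /andP[h _]; apply: f0.
  by apply: lt_le_trans h; rewrite divr_gt0.
Qed.

Lemma measurable_powR_fun (e : R) D : measurable_fun D (fun x : R => x `^ e).
Proof. exact: measurable_funTS (measurable_powR e). Qed.

Lemma integral_powR (k e : R) : 0 < k -> -1 < e ->
  (\int[leb]_(x in `]0%R, k]) (x `^ e)%:E = (k `^ (e + 1) / (e + 1))%:E)%E.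
Proof.
move=> k0 e1; have e10 : 0 < e + 1 by lra.
have mf : measurable_fun `]0, k] (fun x : R => (x `^ e)%:E).
  by apply/measurable_EFinP; exact: measurable_powR_fun.
have f0 (x : R) : 0 < x -> (0 <= (x `^ e)%:E)%E by rewrite lee_fin powR_ge0.
have cv := cvg_shrink_integral k0 mf f0.
apply: (cvg_unique _ cv); first exact: ereal_hausdorff.
pose F (x : R) := (e + 1)^-1 * x `^ (e + 1).
have dF (x : R) : 0 < x -> is_derive x 1 F (x `^ e).
  move=> x0; have h := is_deriveZ (e + 1)^-1 (is_derive1_powR (e + 1) x0).
  by apply: (is_derive_eq h); rewrite /GRing.scale/= addrK mulKf// gt_eqF.
have cF (x : R) : 0 < x -> {for x, continuous F}.
  move=> x0; apply/differentiable_continuous/derivable1_diffP.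
  exact: (@ex_derive _ _ _ _ _ _ _ (dF x x0)).
rewrite (_ : (fun n => _) = (fun n => (F k - F (k / n.+1%:R))%:E)); last first.
  (* At [n = 0] the interval is the single point [k], while the fundamental theorem asks for
     distinct endpoints. *)
  apply/funext => -[|n].
    by rewrite divr1 set_itv1 integral_set1 subrr.
  have a0 : 0 < k / n.+2%:R by rewrite divr_gt0.
  have ak : k / n.+2%:R < k by rewrite ltr_pdivrMr// ltr_pMr// ltr1n.
  rewrite (@continuous_FTC2 _ _ F)//.
  - apply: within_continuous_gt0 => // x; rewrite in_itv/= andbT.
    exact: continuous_powR_gt0.
  - split.
    + move=> x; rewrite in_itv/= => /andP[ax _].
      exact: (@ex_derive _ _ _ _ _ _ _ (dF x (lt_trans a0 ax))).
    + exact/cvg_at_right_filter/cF.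
    + exact/cvg_at_left_filter/cF.
  - move=> x; rewrite in_itv/= => /andP[ax _]; rewrite derive1E.
    exact: (@derive_val _ _ _ _ _ _ _ (dF x (lt_trans a0 ax))).
apply: cvg_EFin; first exact: nearW.
rewrite [X in _ --> X](_ : _ = F k - (e + 1)^-1 * 0); last first.
  by rewrite mulr0 subr0 /F mulrC.
apply: cvgB; first exact: cvg_cst.
apply: cvgMl_tmp.
apply: (@cvg_comp _ _ _ (fun n : nat => k / n.+1%:R) (fun x => x `^ (e + 1)) _ 0^'+); last exact: powR_cvg0.
(* The limit of the power at zero is one-sided, so the positivity of [k / n.+1%:R] has to accompany
   its convergence. *)
move=> A hA.
have h : \forall n \near \oo, 0 < k / n.+1%:R -> A (k / n.+1%:R) := @cvg_shrink k _ hA.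
change (\forall n \near \oo, A (k / n.+1%:R)).
by near=> n; apply: (near h n) => //; rewrite divr_gt0.
Unshelve. all: by end_near. Qed.

(** Here [u] is a squared distance, whence the exponent [alpha / 2] and the lower bound [w ^+ 2].
    The substitution is decreasing and singular at zero, so it is done on [[k / n.+1%:R, k]] and
    both sides pass to the monotone limit. *)
Lemma power_substitution (G : R -> R) (C w alpha : R) :
  0 < C -> 0 < w -> 0 < alpha ->
  (forall x, 0 <= G x) -> measurable_fun setT G ->
  {in `]0, +oo[, forall x, {for x, continuous G}} ->
  (\int[leb]_(u in `[(w ^+ 2)%R, +oo[) (G (C * u `^ (- (alpha / 2))))%:E =
   (2 / alpha * C `^ (2 / alpha))%:E *
   \int[leb]_(v in `]0%R, (C * w `^ (- alpha))%R]) (G v * v `^ (- (2 / alpha) - 1))%:E)%E.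
Proof.
move=> C0 w0 al0 G0 mG cG; set de := 2 / alpha; set k := C * _.
have k0 : 0 < k by rewrite mulr_gt0// powR_gt0.
have de0 : 0 < de by rewrite divr_gt0.
pose F (v : R) := C `^ de * v `^ (- de).
have F0 v : 0 < v -> 0 < F v by move=> v0; rewrite mulr_gt0// powR_gt0.
have FK v : 0 < v -> C * F v `^ (- (alpha / 2)) = v.
  move=> v0; rewrite /F powRM ?powR_ge0// -!powRrM.
  have -> : - de * - (alpha / 2) = 1 by rewrite /de; field; rewrite gt_eqF.
  have -> : de * - (alpha / 2) = -1 by rewrite /de; field; rewrite gt_eqF.
  by rewrite powRr1 ?(ltW v0)// powR_inv1 ?(ltW C0)// mulrA divff ?gt_eqF// mul1r.
have Fk : F k = w ^+ 2.
  rewrite /F /k powRM ?(ltW C0) ?powR_ge0// mulrA -powRD; last by apply/implyP => _; rewrite gt_eqF.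
  rewrite subrr powRr0 mul1r -powRrM.
  have -> : - alpha * - de = 2 by rewrite /de; field; rewrite gt_eqF.
  by rewrite powR_mulrn ?(ltW w0).
have dF (x : R) : 0 < x -> is_derive x 1 F (- (de * C `^ de * x `^ (- de - 1))).
  move=> x0; have h := is_deriveZ (C `^ de) (is_derive1_powR (- de) x0).
  by apply: (is_derive_eq h); rewrite /GRing.scale/=; ring.
have cF (x : R) : 0 < x -> {for x, continuous F}.
  move=> x0; apply/differentiable_continuous/derivable1_diffP.
  exact: (@ex_derive _ _ _ _ _ _ _ (dF x x0)).
have F'E : {in `]0, +oo[, derive1 F =1 (fun x => - (de * C `^ de * x `^ (- de - 1)))}.
  move=> x; rewrite in_itv/= andbT => x0; rewrite derive1E.
  exact: (@derive_val _ _ _ _ _ _ _ (dF x x0)).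
have cF' (x : R) : 0 < x -> {for x, continuous (derive1 F)}.
  move=> x0; apply: eq_gt0_continuous F'E _ => //.
  by apply: cvgN; apply: cvgMl_tmp; exact: continuous_powR_gt0.
have decF : {in `]0, +oo[ &, {homo F : x y /~ x < y}}.
  move=> x y; rewrite !in_itv/= !andbT => x0 y0 yx.
  rewrite /F ltr_pM2l ?powR_gt0// !powRN ltf_pV2 ?posrE ?powR_gt0//.
  by apply: gt0_ltr_powR => //; rewrite nnegrE ltW.
have leF x y : 0 < x -> x <= y -> F y <= F x.
  move=> x0; rewrite le_eqVlt => /predU1P[->//|xy]; apply/ltW/decF => //.
    by rewrite in_itv/= andbT (lt_trans x0).
  by rewrite in_itv/= andbT.
have FK' u : 0 < u -> F (C * u `^ (- (alpha / 2))) = u.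
  move=> u0; rewrite /F powRM ?(ltW C0) ?powR_ge0// mulrA -powRD; last by apply/implyP => _; rewrite gt_eqF.
  rewrite subrr powRr0 mul1r -powRrM.
  have -> : - (alpha / 2) * - de = 1 by rewrite /de; field; rewrite gt_eqF.
  by rewrite powRr1 ?(ltW u0).
pose H (u : R) := G (C * u `^ (- (alpha / 2))).
have cH (u : R) : 0 < u -> {for u, continuous H}.
  move=> u0; apply: (@continuous_comp _ _ _ (fun u : R => C * u `^ (- (alpha / 2))) G).
    by apply: cvgMl_tmp; exact: continuous_powR_gt0.
  by apply: cG; rewrite in_itv/= andbT mulr_gt0// powR_gt0.
have mGv : measurable_fun `]0, k] (fun v : R => (G v * v `^ (- de - 1))%:E).
  apply/measurable_EFinP; apply: measurable_funM; first exact: measurable_funTS.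
  exact: measurable_powR_fun.
have Gv0 (v : R) : 0 < v -> (0 <= (G v * v `^ (- de - 1))%:E)%E.
  by move=> v0; rewrite lee_fin mulr_ge0// powR_ge0.
have step n : (\int[leb]_(u in `[(w ^+ 2)%R, F (k / n.+1%:R)%R]) (H u)%:E =
    (de * C `^ de)%:E * \int[leb]_(v in `[(k / n.+1%:R)%R, k]) (G v * v `^ (- de - 1))%:E)%E.
  have b0 : 0 < k / n.+1%:R by rewrite divr_gt0.
  have bk : k / n.+1%:R <= k by rewrite ler_pdivrMr// ler_pMr// ler1n.
  have pos x : k / n.+1%:R <= x -> 0 < x by exact: lt_le_trans.
  rewrite -Fk integration_by_substitution_decreasing//; last 6 first.
  - move=> x y; rewrite !in_itv/= => /andP[hx _] /andP[hy _].
    by apply: decF; rewrite in_itv/= andbT pos.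
  - move=> x; rewrite in_itv/= => /andP[hx _]; apply: cF'; exact: (pos _ (ltW hx)).
  - by apply/cvg_ex; eexists; apply/cvg_at_right_filter/cF'.
  - by apply/cvg_ex; eexists; apply/cvg_at_left_filter/cF'.
  - split.
    + move=> x; rewrite in_itv/= => /andP[hx _].
      exact: (@ex_derive _ _ _ _ _ _ _ (dF x (pos _ (ltW hx)))).
    + exact/cvg_at_right_filter/cF.
    + exact/cvg_at_left_filter/cF.
  - apply: within_continuous_gt0; first exact: F0.
    by move=> x; rewrite in_itv/= andbT; exact: cH.
  rewrite -ge0_integralZl//; last 3 first.
  - apply: (measurable_funS _ _ mGv) => // x /=; rewrite !in_itv/= => /andP[hx ->].
    by rewrite andbT pos.
  - by move=> x /=; rewrite in_itv/= => /andP[hx _]; apply: Gv0; exact: pos hx.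
  - by rewrite lee_fin mulr_ge0 ?powR_ge0// ltW.
  apply: eq_integral => x; rewrite inE/= in_itv/= => /andP[hx _].
  have x0 := pos _ hx.
  rewrite -EFinM; congr EFin; rewrite !fctE/= F'E; last by rewrite in_itv/= andbT.
  by rewrite opprK /H FK//; ring.
have cv2 : (\int[leb]_(u in `[(w ^+ 2)%R, F (k / n.+1%:R)%R]) (H u)%:E @[n --> \oo] -->
    \int[leb]_(u in `[(w ^+ 2)%R, +oo[) (H u)%:E)%E.
  have Fnd m n : (m <= n)%N -> F (k / m.+1%:R) <= F (k / n.+1%:R).
    rewrite leq_eqVlt => /predU1P[->//|mn]; apply/ltW/decF.
    - by rewrite in_itv/= andbT divr_gt0.
    - by rewrite in_itv/= andbT divr_gt0.
    - by rewrite ltr_pM2l// ltf_pV2 ?posrE// ltr_nat ltnS.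
  have mH : measurable_fun setT (fun u => (H u)%:E).
    apply/measurable_EFinP; apply: (measurableT_comp mG).
    apply: measurable_funM => //; exact: measurable_powR_fun.
  (* The upper ends [F (k / n.+1%:R)] exhaust the half-line: a given [u] is reached once its image
     under the inverse of [F] lies above [k / n.+1%:R]. *)
  have -> : `[w ^+ 2, +oo[%classic = \bigcup_n `[w ^+ 2, F (k / n.+1%:R)]%classic.
    apply/seteqP; split => u /=; rewrite in_itv/= ?andbT.
      move=> wu; have u0 : 0 < u by apply: lt_le_trans wu; rewrite exprn_gt0.
      have : (\bigcup_n `[k / n.+1%:R, k]%classic) (C * u `^ (- (alpha / 2))).
        rewrite bigcup_itv_shrink//= in_itv/= mulr_gt0 ?powR_gt0//=.
        (* Were the image of [u] above [k], monotonicity of [F] would force [u = w ^+ 2], whose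
           image is [k] itself. *)
        rewrite leNgt; apply/negP => h.
        have := leF _ _ k0 (ltW h); rewrite FK'// Fk => h'.
        have uw : u = w ^+ 2 by apply/eqP; rewrite eq_le h' wu.
        have := FK _ k0; rewrite Fk -uw => kE.
        by move: h; rewrite kE ltxx.
      move=> [n _]; rewrite /= in_itv/= => /andP[h _]; exists n => //=.
      by rewrite in_itv/= wu/= -[u in leLHS]FK'// leF// divr_gt0.
    by move=> [n _]; rewrite /= in_itv/= => /andP[].
  apply: ge0_nondecreasing_set_cvg_integral.
  - move=> m n mn; apply/subsetPset => u /=; rewrite !in_itv/= => /andP[-> h] /=.
    exact: le_trans h (Fnd _ _ mn).
  - by move=> n; exact: measurable_itv.
  - by move=> n; exact: measurable_funTS.
  - by move=> n u _; rewrite lee_fin G0.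
apply: (cvg_unique _ cv2); first exact: ereal_hausdorff.
rewrite (_ : (fun n => _) = fun n => ((de * C `^ de)%:E *
    \int[leb]_(v in `[(k / n.+1%:R)%R, k]) (G v * v `^ (- de - 1))%:E)%E); last first.
  by apply/funext => n; rewrite step.
by apply: cvgeZl => //; exact: cvg_shrink_integral.
Qed.

End power_substitution.

Section annulus.
Context {R : realType}.
Notation leb := (@lebesgue_measure R).

Lemma annulus_integral (G : R -> R) (C w alpha : R) :
  0 < C -> 0 < w -> 0 < alpha ->
  (forall x, 0 <= G x) -> measurable_fun setT G ->
  {in `]0, +oo[, forall x : R, {for x, continuous G}} ->
  (\int[leb \x leb]_y (if (w < norm2 y)%R then G (C * norm2 y `^ (- alpha))%R else 0%R)%:E =
   (pi * (2 / alpha * C `^ (2 / alpha)))%:E *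
   \int[leb]_(v in `]0%R, (C * w `^ (- alpha))%R]) (G v * v `^ (- (2 / alpha) - 1))%:E)%E.
Proof.
move=> C0 w0 al0 G0 mG cG.
pose H (u : R) := G (C * u `^ (- (alpha / 2))).
have mH : measurable_fun setT H.
  apply: (measurableT_comp mG); apply: measurable_funM => //; exact: measurable_powR_fun.
pose h (u : R) : \bar R := (if w ^+ 2 < u then H u else 0)%:E.
have mh : measurable_fun setT h.
  by apply/measurable_EFinP; apply: measurable_fun_ifT => //; exact: measurable_fun_ltr.
have h0 u : (0 <= h u)%E by rewrite lee_fin /h/H; case: ifP.
transitivity (\int[leb \x leb]_y h (y.1 ^+ 2 + y.2 ^+ 2)%R)%E.
  apply: eq_integral => y _; rewrite /h /H /norm2.
  set u := y.1 ^+ 2 + y.2 ^+ 2; have u0 : 0 <= u by rewrite addr_ge0 ?sqr_ge0.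
  have -> : (w < Num.sqrt u) = (w ^+ 2 < u).
    by rewrite -[LHS](ltr_pXn2r (ltn0Sn 1)) ?nnegrE ?sqrtr_ge0 ?(ltW w0)// sqr_sqrtr.
  case: ifP => // _; congr (G _)%:E; congr (_ * _).
  by rewrite -powR12_sqrt// -powRrM; congr (_ `^ _); field.
rewrite polar_integral// EFinM -muleA -power_substitution//; congr (_ * _)%E.
(* The annulus leads to an open half-line and [power_substitution] to a closed one; they differ by a
   null point. *)
have mHI : measurable_fun (`]w ^+ 2, +oo[%classic : set R) (fun u => (H u)%:E).
  by apply/measurable_EFinP; exact: (measurable_funTS mH).
rewrite -[RHS]integral_itv_obnd_cbnd; last exact: mHI.
rewrite [LHS]integral_mkcond [RHS]integral_mkcond; apply: eq_integral => u _.
rewrite !patchE /h /H !mem_setE !in_itv/= !andbT.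
case: (ltP (w ^+ 2) u) => // h1; last by case: ifP.
by rewrite (le_trans _ (ltW h1)) ?sqr_ge0.
Qed.

End annulus.

(** * Laplace exponent of one tier outside its exclusion disk *)

Section laplace_exponents.
Context {R : realType} (p : hetnet_params R).
Hypothesis N0 : (0 < N p)%N.
Notation leb := (@lebesgue_measure R).
Notation T := ((R * R) * R)%type.

(** Clipping the mark at zero makes the function nonnegative everywhere, as [ppp_laplace_transform]
    asks. Since marks are almost surely positive, the received power is almost surely unchanged. *)
Definition faded (c w alpha : R) (z : T) : R :=
  if w < norm2 z.1 then c * Num.max z.2 0 * norm2 z.1 `^ (- alpha) else 0.

Lemma faded_ge0 c w alpha z : 0 <= c -> 0 <= faded c w alpha z.
Proof.
move=> c0; rewrite /faded; case: ifP => // _.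
by rewrite !mulr_ge0 ?powR_ge0// le_max lexx orbT.
Qed.

Lemma measurable_faded c w alpha : measurable_fun setT (faded c w alpha).
Proof.
have mn : measurable_fun setT (fun z : T => norm2 z.1).
  exact: (measurableT_comp measurable_norm2).
apply: measurable_fun_ifT => //; first exact: measurable_fun_ltr.
apply: measurable_funM.
  apply: measurable_funM => //; exact: measurable_maxr.
exact: (measurableT_comp (measurable_powR (- alpha)) mn).
Qed.

(** Integrates over the mark first: at a fixed position this is the Laplace transform of the Gamma
    law. *)
Lemma laplace_exponent_faded i (c w alpha : R) : 0 <= c ->
  laplace_exponent p i (faded c w alpha) =
  ((lam p i)%:E * \int[leb \x leb]_y (if (w < norm2 y)%R
     then 1 - ((1 + c * norm2 y `^ (- alpha)) ^+ mark_order p i)^-1 else 0)%R%:E)%E.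
Proof.
move=> c0; rewrite /laplace_exponent; congr (_ * _)%E.
rewrite integral_vol3E; last 2 first.
- apply/measurable_EFinP; apply: measurable_funM; last exact: measurable_mark_density2.
  apply: measurable_funB => //; apply: measurableT_comp => //.
  by apply: measurableT_comp => //; exact: measurable_faded.
- move=> z; rewrite lee_fin mulr_ge0 ?mark_density_ge0// subr_ge0 expR_le1 oppr_le0.
  exact: faded_ge0.
apply: eq_integral => y _; rewrite /faded/=; case: ifP => wy; last first.
  by rewrite integral0_eq// => t _; rewrite oppr0 expR0 subrr mul0r.
rewrite -integral_laplace_gamma ?mark_order_gt0 ?mulr_ge0 ?powR_ge0//.
apply: eq_integral => t _; rewrite mark_densityE.
(* At mark zero the two integrands agree, and below it the density vanishes. *)
have [t0|t0] := leP t 0.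
  have [->|tn] := eqVneq t 0; first by rewrite !mulr0 mul0r.
  rewrite /gamma_density ifF ?mulr0//; apply/negbTE; rewrite -ltNge lt_neqAle tn.
  exact: t0.
by rewrite [_ * t * _]mulrAC.
Qed.

(** The coefficient is split as [b * C] so that the choice of [C] fixes the upper limit: it becomes
    [1] for small cells, with [b = eps / Bt p i k], and the argument of the incomplete Beta function
    for the macro tier, with [b = 1]. *)
Lemma laplace_exponent_annulus i (b C w alpha : R) :
  0 <= b -> 0 < C -> 0 < w -> 0 < alpha ->
  laplace_exponent p i (faded (b * C) w alpha) =
  ((lam p i * (pi * (2 / alpha * C `^ (2 / alpha))))%:E *
   \int[leb]_(v in `]0%R, (C * w `^ (- alpha))%R])
     ((1 - ((1 + b * v) ^+ mark_order p i)^-1) * v `^ (- (2 / alpha) - 1))%:E)%E.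
Proof.
move=> b0 C0 w0 al0; rewrite laplace_exponent_faded ?mulr_ge0 ?(ltW C0)//.
rewrite EFinM -muleA; congr (_ * _)%E.
set n := mark_order p i.
(* Clipping the argument keeps the denominator at least one, which makes [G] continuous on the whole
   line. *)
pose G (x : R) := 1 - ((1 + b * Num.max x 0) ^+ n)^-1.
have pos (x : R) : 1 <= 1 + b * Num.max x 0.
  by rewrite lerDl mulr_ge0// le_max lexx orbT.
have G0 x : 0 <= G x by rewrite subr_ge0 invf_le1 ?exprn_ege1// exprn_gt0// (lt_le_trans ltr01).
have cG : continuous G.
  move=> x; apply: cvgB; first exact: cvg_cst.
  apply: cvgV; first by rewrite expf_neq0// gt_eqF// (lt_le_trans ltr01).
  apply: (@continuous_comp _ _ _ (fun x : R => 1 + b * Num.max x 0) (fun y : R => y ^+ n)).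
    apply: cvgD; first exact: cvg_cst.
    apply: cvgMl_tmp; apply: continuous_max => //; exact: cvg_cst.
  exact: exprn_continuous.
transitivity (\int[leb \x leb]_y (if (w < norm2 y)%R then G (C * norm2 y `^ (- alpha))%R else 0%R)%:E)%E.
  apply: eq_integral => y _; case: ifP => // _; rewrite /G max_l; last first.
    by rewrite mulr_ge0 ?powR_ge0// ltW.
  by rewrite mulrA.
have mG := continuous_measurable_fun cG.
rewrite annulus_integral//; last by move=> x _; exact: cG.
congr (_ * _)%E; apply: eq_integral => v; rewrite inE/= in_itv/= => /andP[v0 _].
by rewrite /G max_l// ltW.
Qed.

End laplace_exponents.

(** * Hypergeometric and incomplete Beta functions *)

Section special_functions.
Context {R : realType}.
Notation leb := (@lebesgue_measure R).

Lemma Rintegral_itv_closed0 (k : R) (f : R -> R) : measurable_fun setT f ->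
  Rintegral leb `[0, k] f = fine (\int[leb]_(x in `]0%R, k]) (f x)%:E)%E.
Proof.
move=> mf; rewrite /Rintegral integral_itv_obnd_cbnd//.
by apply/measurable_EFinP; exact: (measurable_funTS mf).
Qed.

Lemma integral_powR_bound_fin (k e c : R) (f : R -> R) : 0 < k -> -1 < e ->
  measurable_fun setT f ->
  (forall x, 0 < x <= k -> 0 <= f x <= c * x `^ e) ->
  (\int[leb]_(x in `]0%R, k]) (f x)%:E)%E \is a fin_num.
Proof.
move=> k0 e1 mf fc; have c0 : 0 <= c.
  have /fc /andP[h1 h2] : 0 < k <= k by rewrite k0 lexx.
  by rewrite -(pmulr_lge0 _ (powR_gt0 e k0)) (le_trans h1).
have f0 x : `]0, k]%classic x -> (0 <= (f x)%:E)%E.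
  by rewrite /= in_itv/= => /fc /andP[+ _]; rewrite lee_fin.
have mp : measurable_fun `]0, k] (fun x : R => (x `^ e)%:E).
  by apply/measurable_EFinP; exact: measurable_powR_fun.
rewrite ge0_fin_numE; last exact: integral_ge0.
apply: (@le_lt_trans _ _ (\int[leb]_(x in `]0%R, k]) (c%:E * (x `^ e)%:E))%E).
  apply: ge0_le_integral => //.
  - by apply/measurable_EFinP; exact: measurable_funTS.
  - exact: measurable_funeM.
  - by move=> x /=; rewrite in_itv/= => /fc /andP[_]; rewrite -EFinM lee_fin.
rewrite ge0_integralZl//; first by rewrite integral_powR// -EFinM ltry.
by move=> x _; rewrite lee_fin powR_ge0.
Qed.

Lemma measurable_powR_affine (a b : R) (e : R) :
  measurable_fun setT (fun t : R => (a + b * t) `^ e).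
Proof.
apply: (measurableT_comp (measurable_powR e)).
by apply: measurable_funD => //; exact: measurable_funM.
Qed.

(** For parameters [1], [1 - de], [2 - de] the exponent of [1 - t] in Euler's integral is zero, and
    the Beta normalisation is the inverse of [1 - de]. *)
Lemma hyp2F1_integral (de k : R) : 0 < de < 1 -> 0 <= k ->
  (\int[leb]_(v in `]0%R, 1%R]) (v `^ (- de) / (1 + k * v))%:E =
   (hyp2F1 1 (1 - de) (2 - de) (- k) / (1 - de))%:E)%E.
Proof.
move=> /andP[de0 de1] k0; rewrite /hyp2F1.
have E1 : 2 - de - (1 - de) - 1 = 0 by lra.
have E2 : 1 - de - 1 = - de by lra.
rewrite E1 E2.
have -> : Rintegral leb `[0, 1] (fun t => t `^ (- de) * (1 - t) `^ 0) = (1 - de)^-1.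
  (* The zeroth power is one for every base, so the factor disappears at [t = 1] as well. *)
  rewrite (_ : (fun t => _) = fun t : R => t `^ (- de)); last first.
    by apply/funext => t; rewrite powRr0 mulr1.
  rewrite Rintegral_itv_closed0; last exact: measurable_powR_fun.
  by rewrite integral_powR//; [rewrite /= powR1 mul1r addrC|lra].
rewrite invrK -mulrA divff ?mulr1; last by rewrite gt_eqF//; lra.
rewrite (_ : (fun t => _) = fun t : R => t `^ (- de) * (1 + k * t) `^ (-1)); last first.
  by apply/funext => t; rewrite powRr0 mulr1 mulNr opprK.
have mf : measurable_fun setT (fun t : R => t `^ (- de) * (1 + k * t) `^ (-1)).
  by apply: measurable_funM; [exact: measurable_powR_fun|exact: measurable_powR_affine].
rewrite Rintegral_itv_closed0// fineK; last first.
  apply: (@integral_powR_bound_fin _ (- de) 1) => //; first by lra.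
  move=> x /andP[x0 _]; rewrite mulr_ge0 ?powR_ge0//= mul1r ler_piMr ?powR_ge0//.
  rewrite powR_inv1; last by rewrite addr_ge0// mulr_ge0// ltW.
  by rewrite invf_le1 ?lerDl ?ltr_wpDr// mulr_ge0// ltW.
apply: eq_integral => v; rewrite inE/= in_itv/= => /andP[v0 _].
by rewrite powR_inv1// addr_ge0// mulr_ge0// ltW.
Qed.

Import complex.
Local Open Scope complex_scope.

Lemma expiD (a b : R) : expi a * expi b = expi (a + b).
Proof. by rewrite /expi cosD sinD; simpc; congr (_ +i* _); ring. Qed.

Lemma macro_phase (de q J : R) :
  negpow 1 (de - q) * (- (expi (pi * (q - de - 1)) * J%:C)) = J%:C.
Proof.
rewrite /negpow powR1 mulrN mulrA -[_%:C * expi _ * _]mulrA expiD -mulrDr.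
have -> : de - q + (q - de - 1) = -1 by ring.
by rewrite mulrN1 /expi cosN sinN cospi sinpi; simpc.
Qed.

(** Writes [1 - ((1 + v) ^+ n)^-1] as [(1 + v) ^+ n - 1] over [(1 + v) ^+ n] and expands the
    numerator; the missing constant term is why the sum starts at [q = 1]. *)
Lemma macro_sum (n : nat) (de v : R) : 0 < v ->
  \sum_(1 <= q < n.+1) 'C(n, q)%:R * (v `^ (q%:R - de - 1) * (1 + v) `^ (1 - n%:R - 1)) =
  (1 - ((1 + v) ^+ n)^-1) * v `^ (- de - 1).
Proof.
move=> v0; have v1 : 0 < 1 + v by rewrite addr_gt0.
have vn : (1 + v) ^+ n != 0 by rewrite expf_neq0// gt_eqF.
have -> : (1 + v) `^ (1 - n%:R - 1) = ((1 + v) ^+ n)^-1.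
  by rewrite (_ : 1 - n%:R - 1 = - n%:R) ?powR_invn ?(ltW v1)//; ring.
transitivity ((\sum_(1 <= q < n.+1) 'C(n, q)%:R * v ^+ q) * (((1 + v) ^+ n)^-1 * v `^ (- de - 1))).
  rewrite mulr_suml; apply: eq_bigr => q _.
  rewrite (_ : q%:R - de - 1 = q%:R + (- de - 1)); last by ring.
  rewrite powRD; last by apply/implyP => _; rewrite gt_eqF.
  by rewrite powR_mulrn ?(ltW v0)//; ring.
have -> : \sum_(1 <= q < n.+1) 'C(n, q)%:R * v ^+ q = (1 + v) ^+ n - 1.
  rewrite exprDn -(big_mkord xpredT (fun i => (1 ^+ (n - i) * v ^+ i) *+ 'C(n, i))).
  rewrite [in RHS]big_ltn// subn0 expr1n expr0 mul1r bin0 mulr1n addrC addKr.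
  by apply: eq_bigr => q _; rewrite expr1n mul1r mulr_natl.
by rewrite mulrA mulrBl divff// mul1r.
Qed.

End special_functions.

(** * Realness and integral form of the macro-tier term *)

Section macro_Q.
Context {R : realType} (p : hetnet_params R) (k : nat) (eps : R).
Notation leb := (@lebesgue_measure R).
Import complex.
Local Open Scope complex_scope.
Let y := eps * an p k * Bb p k / GM p.
Let de := delta p 1.
Let J q := Rintegral leb `[0, y] (fun u => u `^ (q%:R - de - 1) * (1 + u) `^ (1 - (N p)%:R - 1)).

Lemma Qmacro_real : Qmacro p k eps = (\sum_(1 <= q < (N p).+1) 'C(N p, q)%:R * J q)%:C.
Proof.
rewrite /Qmacro raddf_sum/=; apply: eq_bigr => q _.
rewrite /incBeta_neg -mulrA macro_phase.
by apply/eqP; rewrite eq_complex/=; simpc. 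
Qed.

Lemma Qmacro_Im0 : Qmacro_Im p k eps = 0.
Proof. by rewrite /Qmacro_Im Qmacro_real. Qed.

Lemma Qmacro_Re : 0 < y -> 0 < de < 1 ->
  (\int[leb]_(v in `]0%R, y]) ((1 - ((1 + v) ^+ N p)^-1) * v `^ (- de - 1))%:E =
   (Re (Qmacro p k eps))%:E)%E.
Proof.
move=> y0 /andP[de0 de1]; rewrite Qmacro_real/=.
pose f q (u : R) := u `^ (q%:R - de - 1) * (1 + u) `^ (1 - (N p)%:R - 1).
have mf q : measurable_fun setT (f q).
  apply: measurable_funM; first exact: measurable_powR_fun.
  rewrite (_ : (fun x => _) = fun x : R => (1 + 1 * x) `^ (1 - (N p)%:R - 1)).
    exact: measurable_powR_affine.
  by apply/funext => x; rewrite mul1r.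
have f0 q u : 0 <= f q u by rewrite mulr_ge0 ?powR_ge0.
have fin q : (0 < q)%N -> (\int[leb]_(u in `]0%R, y]) (f q u)%:E)%E \is a fin_num.
  move=> q0; have q1 : 1 <= q%:R :> R by rewrite ler1n.
  (* The exponent exceeds [-1] because [1 <= q] and [de < 1], and the factor in [1 + x] is at most
     one. *)
  apply: (@integral_powR_bound_fin _ _ (q%:R - de - 1) 1) => //; first by lra.
  move=> x /andP[x0 _]; rewrite f0/= mul1r ler_piMr ?powR_ge0//.
  rewrite (_ : 1 - (N p)%:R - 1 = - (N p)%:R); last by ring.
  rewrite powR_invn; last by rewrite addr_ge0// ltW.
  rewrite invf_le1; last by rewrite exprn_gt0// addr_gt0.
  by rewrite exprn_ege1// lerDl ltW.
transitivity (\int[leb]_(v in `]0%R, y]) \sum_(1 <= q < (N p).+1) ('C(N p, q)%:R%:E * (f q v)%:E))%E.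
  apply: eq_integral => v; rewrite inE/= in_itv/= => /andP[v0 _].
  by rewrite -macro_sum// -sumEFin; apply: eq_bigr => q _; rewrite -EFinM.
rewrite ge0_integral_sum//; last 2 first.
- by move=> q; apply: measurable_funeM; apply/measurable_EFinP; exact: (measurable_funTS (mf q)).
- by move=> q v _; rewrite mule_ge0// lee_fin.
rewrite -sumEFin !big_nat; apply: eq_bigr => q /andP[q0 _].
rewrite ge0_integralZl//; last 2 first.
- by apply/measurable_EFinP; exact: (measurable_funTS (mf q)).
- by move=> v _; rewrite lee_fin.
rewrite /J Rintegral_itv_closed0; last exact: mf.
by rewrite EFinM fineK// fin.
Qed.

End macro_Q.

(** Inversion is the power [-1] up to sign on each half-line; at zero both conventions give zero. *)
Lemma measurable_invr (R : realType) : measurable_fun [set: R] (fun x : R => x^-1).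
Proof.
rewrite (_ : (fun x => _) =
    fun x : R => if 0 <= x then x `^ (-1) else - ((- x) `^ (-1))); last first.
  apply/funext => x; case: ifPn => [x0|]; first by rewrite powR_inv1.
  by rewrite -ltNge => x0; rewrite powR_inv1 ?oppr_ge0 ?(ltW x0)// invrN opprK.
apply: measurable_fun_ifT; first exact: measurable_fun_ler.
- exact: measurable_powR.
- apply: measurableT_comp => //; apply: (measurableT_comp (measurable_powR (-1))).
  exact: oppr_measurable.
Qed.

(** * Closed forms of the tier exponents *)

Section tier_exponents.
Context {R : realType} (p : hetnet_params R) (k : nat) (x eps : R).
Hypothesis kK : (2 <= k <= K p)%N.
Hypothesis N2 : (2 <= N p)%N.
Hypothesis Pw0 : forall i, (1 <= i <= K p)%N -> 0 < Pw p i.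
Hypothesis al2 : forall i, (1 <= i <= K p)%N -> 2 < alpha p i.
Hypothesis noma0 : forall i, (2 <= i <= K p)%N -> [/\ 0 < Bb p i, 0 < am p i & 0 < an p i].
Hypothesis x0 : 0 < x.
Hypothesis eps0 : 0 < eps.

Let in1 i : (2 <= i <= K p)%N -> (1 <= i <= K p)%N.
Proof. by move=> /andP[i2 ->]; rewrite (ltnW i2). Qed.

Let oneK : (1 <= 1 <= K p)%N.
Proof. by case/andP: kK => k2 /(leq_trans k2)/ltnW ->. Qed.

Lemma Pt_gt0 i : (1 <= i <= K p)%N -> 0 < Pt p i k.
Proof. by move=> iK; rewrite divr_gt0 ?Pw0// in1. Qed.

Lemma Bt_gt0 i : (2 <= i <= K p)%N -> 0 < Bt p i k.
Proof. by move=> iK; have [? _ _] := noma0 iK; have [? _ _] := noma0 kK; rewrite divr_gt0. Qed.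

Lemma GM_gt0 : 0 < GM p.
Proof. by rewrite ltr0n addn1. Qed.

Lemma alpha_gt0 i : (1 <= i <= K p)%N -> 0 < alpha p i.
Proof. by move=> iK; apply: lt_trans (al2 iK). Qed.

Lemma delta_itv i : (1 <= i <= K p)%N -> 0 < delta p i < 1.
Proof.
move=> iK; have a0 := alpha_gt0 iK.
by rewrite divr_gt0//= ltr_pdivrMr// mul1r al2.
Qed.

(** As [delta p i / 2 * alpha p i = 1], raising an exclusion radius to the power [alpha p i]
    recovers the power ratio times a power of [x] free of the tier's own exponent. *)
Lemma radius_powR (c a : R) i : (1 <= i <= K p)%N -> 0 < c ->
  (c `^ (delta p i / 2) * x `^ (a / alpha p i)) `^ alpha p i = c * x `^ a.
Proof.
move=> iK c0; have ai0 := alpha_gt0 iK.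
rewrite powRM ?powR_ge0// -!powRrM.
have -> : delta p i / 2 * alpha p i = 1 by rewrite /delta; field; rewrite gt_eqF.
have -> : a / alpha p i * alpha p i = a by field; rewrite gt_eqF.
by rewrite powRr1// ltW.
Qed.

Lemma omega_ik_gt0 i : (2 <= i <= K p)%N -> 0 < omega_ik p i k x.
Proof.
by move=> iK; rewrite mulr_gt0 ?powR_gt0// mulr_gt0 ?Bt_gt0 ?Pt_gt0 ?in1.
Qed.

Let macro_ratio_gt0 : 0 < Pt p 1 k * GM p / (an p k * Bb p k * (N p)%:R).
Proof.
have [B0 _ a0] := noma0 kK.
have N0 : 0 < (N p)%:R :> R by rewrite ltr0n (ltn_trans _ N2).
apply: divr_gt0; first by apply: mulr_gt0; [exact: Pt_gt0|exact: GM_gt0].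
by apply: mulr_gt0 => //; exact: mulr_gt0.
Qed.

Lemma omega_1k_gt0 : 0 < omega_1k p k x.
Proof. by apply: mulr_gt0; apply: powR_gt0. Qed.

Definition small_exponent i : R :=
  lam p i * delta p i * pi * Bt p i k `^ (delta p i - 1)
    * Pt p i k `^ delta p i * x `^ (2 * alpha p k / alpha p i)
    / (1 - delta p i) * Qsmall p i k eps.

Definition macro_exponent : R :=
  lam p 1 * delta p 1 * pi * (Pt p 1 k * eps / (N p)%:R) `^ delta p 1
    * x `^ (2 * alpha p k / alpha p 1) * complex.Re (Qmacro p k eps).

Lemma laplace_exponent_small i : (2 <= i <= K p)%N ->
  laplace_exponent p i (faded (eps * Pt p i k * x `^ alpha p k) (omega_ik p i k x) (alpha p i))
  = (small_exponent i)%:E.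
Proof.
move=> iK; have i1 := in1 iK; set w := omega_ik p i k x; set de := delta p i.
have ai0 := alpha_gt0 i1; have /andP[de0 de1] := delta_itv i1.
have B0 := Bt_gt0 iK; have P0 := Pt_gt0 i1; have w0 := omega_ik_gt0 iK.
set C := Bt p i k * Pt p i k * x `^ alpha p k; set kap := eps / Bt p i k.
have C0 : 0 < C by apply: mulr_gt0; [exact: mulr_gt0|exact: powR_gt0].
have kap0 : 0 < kap by rewrite divr_gt0.
have wC : w `^ alpha p i = C by rewrite /w /omega_ik radius_powR// mulr_gt0.
have -> : eps * Pt p i k * x `^ alpha p k = kap * C.
  by rewrite /kap /C; field; rewrite gt_eqF.
rewrite laplace_exponent_annulus ?(ltW kap0)//; last exact: leq_trans N2.
have -> : C * w `^ (- alpha p i) = 1 by rewrite powRN wC divff// gt_eqF.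
have -> : mark_order p i = 1%N.
  by rewrite /mark_order gtn_eqF//; case/andP: iK.
rewrite -/(delta p i) -/de.
have mi : measurable_fun [set: R] (fun v : R => (1 + kap * v)^-1).
  apply: (@measurableT_comp _ _ _ _ _ _ (fun x : R => x^-1) setT
    (fun v : R => 1 + kap * v) (@measurable_invr R)).
  by apply: measurable_funD => //; exact: measurable_funM.
(* For a mark of order one, [1 - (1 + kap * v)^-1] is [kap * v / (1 + kap * v)], and the extra [v]
   raises the exponent from [- de - 1] to [- de]. *)
transitivity ((lam p i * (pi * (de * C `^ de)))%:E * (kap%:E *
   \int[@lebesgue_measure R]_(v in `]0%R, 1%R]) (v `^ (- de) / (1 + kap * v))%:E))%E.
  congr (_ * _)%E; rewrite -ge0_integralZl//; last 3 first.
  - apply/measurable_EFinP; apply: measurable_funTS; apply: measurable_funM; first exact: measurable_powR_fun.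
    exact: mi.
  - move=> v /=; rewrite in_itv/= => /andP[v0 _]; rewrite lee_fin divr_ge0 ?powR_ge0//.
    by rewrite addr_ge0// mulr_ge0// ltW.
  - by rewrite lee_fin ltW.
  apply: eq_integral => v; rewrite inE/= in_itv/= => /andP[v0 _]; rewrite -EFinM; congr EFin.
  have -> : v `^ (- de) = v * v `^ (- de - 1).
    have e : v `^ (1 + (- de - 1)) = v * v `^ (- de - 1).
      rewrite powRD; last by apply/implyP => _; rewrite gt_eqF.
      by rewrite powRr1// ltW.
    by rewrite -e; congr (_ `^ _); ring.
  have : 1 + kap * v != 0 by rewrite gt_eqF// addr_gt0// mulr_gt0.
  by move=> h; rewrite expr1; field.
rewrite hyp2F1_integral ?de0 ?(ltW kap0)// -!EFinM; congr EFin.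
rewrite /small_exponent /Qsmall -/de -/kap.
have -> : C `^ de = Bt p i k `^ de * Pt p i k `^ de * x `^ (2 * alpha p k / alpha p i).
  have BP0 : 0 <= Bt p i k * Pt p i k by apply/ltW; exact: mulr_gt0.
  rewrite /C (powRM _ BP0 (powR_ge0 _ _)) (powRM _ (ltW B0) (ltW P0)) -powRrM.
  by congr (_ * _ `^ _); rewrite /de /delta; ring.
have -> : Bt p i k `^ (de - 1) = Bt p i k `^ de / Bt p i k.
  rewrite powRB; last by apply/implyP => _; rewrite gt_eqF.
  by rewrite powRr1// ltW.
have h1 : Bt p i k != 0 by rewrite gt_eqF.
have h2 : 1 - de != 0 by rewrite gt_eqF// subr_gt0.
by rewrite /kap; field; rewrite h1 h2.
Qed.

Lemma laplace_exponent_macro :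
  laplace_exponent p 1 (faded (eps * Pt p 1 k / (N p)%:R * x `^ alpha p k) (omega_1k p k x) (alpha p 1))
  = macro_exponent%:E.
Proof.
set w := omega_1k p k x; set de := delta p 1.
have [Bk0 _ an0] := noma0 kK.
have ai0 := alpha_gt0 oneK; have de01 := delta_itv oneK.
have P0 := Pt_gt0 oneK; have w0 : 0 < w := omega_1k_gt0.
have N0 : 0 < (N p)%:R :> R by rewrite ltr0n (ltn_trans _ N2).
have G0 := GM_gt0.
(* For the macro tier [C] is the whole coefficient, so that [eps] enters through the upper limit. *)
set C := Pt p 1 k * eps / (N p)%:R * x `^ alpha p k.
have C0 : 0 < C.
  by apply: mulr_gt0; [apply: divr_gt0 => //; exact: mulr_gt0|exact: powR_gt0].
have -> : eps * Pt p 1 k / (N p)%:R * x `^ alpha p k = 1 * C.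
  by rewrite /C mul1r [eps * _]mulrC.
rewrite laplace_exponent_annulus//; last exact: leq_trans N2.
have -> : C * w `^ (- alpha p 1) = eps * an p k * Bb p k / GM p.
  rewrite powRN /w /omega_1k radius_powR// /C; field.
  by rewrite !gt_eqF ?powR_gt0.
rewrite -/(delta p 1) -/de.
transitivity ((lam p 1 * (pi * (de * C `^ de)))%:E *
   \int[@lebesgue_measure R]_(v in `]0%R, (eps * an p k * Bb p k / GM p)%R])
     ((1 - ((1 + v) ^+ N p)^-1) * v `^ (- de - 1))%:E)%E.
  by congr (_ * _)%E; apply: eq_integral => v _; rewrite mul1r.
have y0 : 0 < eps * an p k * Bb p k / GM p.
  by apply: divr_gt0 => //; apply: mulr_gt0 => //; exact: mulr_gt0.
rewrite (Qmacro_Re y0 de01) -EFinM; congr EFin.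
rewrite /macro_exponent -/de.
have -> : C `^ de = (Pt p 1 k * eps / (N p)%:R) `^ de * x `^ (2 * alpha p k / alpha p 1).
  have A0 : 0 <= Pt p 1 k * eps / (N p)%:R.
    by apply/ltW/divr_gt0 => //; exact: mulr_gt0.
  rewrite /C (powRM _ A0 (powR_ge0 _ _)) -powRrM.
  by congr (_ * _ `^ _); rewrite /de /delta; ring.
by ring.
Qed.

End tier_exponents.

(** * The coverage event *)

Section sinr_algebra.
Context {R : realFieldType}.
Implicit Types a b S D t : R.

Lemma ratio_threshold a b S D t : 0 < b -> 0 < S -> 0 < D -> 0 < a - t * b ->
  (t < a * S / (b * S + D)) = (t / (a - t * b) * D < S).
Proof.
move=> b0 S0 D0 A0; have den : 0 < b * S + D by rewrite addr_gt0// mulr_gt0.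
rewrite ltr_pdivlMr// [t / _ * D]mulrAC ltr_pdivrMr//.
by apply/idP/idP; nra.
Qed.

(** The ratio stays below [a / b], hence below [t], however strong the signal. Equality [a = t * b]
    is included, where the threshold of [ratio_threshold] would divide by zero. *)
Lemma ratio_saturated a b S D t : 0 < b -> 0 < S -> 0 < D -> 0 < t -> a - t * b <= 0 ->
  (t < a * S / (b * S + D)) = false.
Proof.
move=> b0 S0 D0 t0 A0; have den : 0 < b * S + D by rewrite addr_gt0// mulr_gt0.
apply/negbTE; rewrite -leNgt ler_pdivrMr//.
have : 0 < t * D by rewrite mulr_gt0.
have : (a - t * b) * S <= 0 by rewrite mulr_le0_ge0// ltW.
by nra.
Qed.

Lemma near_threshold a b S D t t' : 0 < b -> 0 < S -> 0 < D -> 0 < a - t * b ->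
  (t < a * S / (b * S + D)) && (t' < b * S / (0 + D)) =
  (Num.max (t / (a - t * b)) (t' / b) * D < S).
Proof.
move=> b0 S0 D0 A0; rewrite ratio_threshold// add0r maxr_pMl ?(ltW D0)// gt_max.
congr (_ && _); rewrite ltr_pdivlMr// [t' / b * D]mulrAC ltr_pdivrMr//.
by rewrite [b * S]mulrC.
Qed.

End sinr_algebra.

(** * Measurability of limits of signed series *)

Section measurable_limits.
Context {d : measure_display} {T : measurableType d} {R : realType}.

Lemma limn_einf_esup_cvg (u : (\bar R)^nat) : limn_einf u = limn_esup u ->
  u @ \oo --> limn_esup u.
Proof.
move=> E; apply: (@squeeze_cvge _ _ _ _ (einfs u) _ (esups u)).
- apply: nearW => n; apply/andP; split.
    by apply: ereal_inf_lbound; exists n => //=.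
  by apply: ereal_sup_ubound; exists n => //=.
- by rewrite -E limn_einf_lim; exact: is_cvg_einfs.
- by rewrite limn_esup_lim; exact: is_cvg_esups.
Qed.

(** A series of signed terms may diverge at some outcomes. Where the lower and upper limits differ,
    [limn] is the constant [point]; elsewhere it is the upper limit, and the set where they coincide
    is measurable. *)
Lemma measurable_fun_limn (f : nat -> T -> \bar R) :
  (forall n, measurable_fun setT (f n)) ->
  measurable_fun setT (fun w => limn (f ^~ w)).
Proof.
move=> mf.
have ms : measurable_fun setT (fun w => limn_esup (f ^~ w)).
  exact: measurable_fun_limn_esup.
have mi : measurable_fun setT (fun w => limn_einf (f ^~ w)).
  apply: measurableT_comp => //.
  apply: (measurable_fun_limn_esup (f := fun n w => (- f n w)%E)) => n.
  exact: measurableT_comp.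
rewrite (_ : (fun w => _) = fun w =>
    if limn_einf (f ^~ w) == limn_esup (f ^~ w) then limn_esup (f ^~ w) else point).
  by apply: measurable_fun_ifT => //; exact: measurable_fun_eqe.
apply/funext => w; case: eqP => [/limn_einf_esup_cvg h|h]; first exact/cvg_lim.
apply: dvgP => /cvg_ex[l /cvg_limn_einf_sup[hi hs]].
by apply: h; rewrite hi hs.
Qed.

End measurable_limits.

Section unsigned_terms.
Context {R : realType}.
Notation T := ((R * R) * R)%type.

(** Counterpart of [faded] with the unclipped mark, as the terms of [I_M] and [I_S] have it. *)
Definition received (c w alpha : R) (z : T) : R :=
  if w < norm2 z.1 then c * z.2 * norm2 z.1 `^ (- alpha) else 0.

Lemma measurable_received c w alpha : measurable_fun setT (received c w alpha).
Proof.
have mn : measurable_fun setT (fun z : T => norm2 z.1).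
  exact: (measurableT_comp measurable_norm2).
apply: measurable_fun_ifT => //; first exact: measurable_fun_ltr.
apply: measurable_funM; first exact: measurable_funM.
exact: (measurableT_comp (measurable_powR (- alpha)) mn).
Qed.

Lemma faded_received s c w alpha z : 0 <= z.2 ->
  faded (s * c) w alpha z = s * received c w alpha z.
Proof.
by move=> z0; rewrite /faded /received max_l//; case: ifP => _; rewrite ?mulr0// !mulrA.
Qed.

End unsigned_terms.

(** * Almost sure positivity of the marks and existence of far points *)

Section almost_sure.
Context {R : realType} (p : hetnet_params R) {d : measure_display}
  {Omega : measurableType d} (P : probability Omega R)
  (X : nat -> Omega -> nat -> (R * R) * R) (go : Omega -> R).
Hypothesis law : hetnet_law p P X go.
Hypothesis lam0 : forall i, (1 <= i <= K p)%N -> 0 < lam p i.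
Hypothesis N0 : (0 < N p)%N.
Notation leb := (@lebesgue_measure R).
Notation T := ((R * R) * R)%type.

Let nonpos : set T := [set z | z.2 <= 0].

Let mnonpos : measurable nonpos.
Proof.
rewrite /nonpos -[X in measurable X]setTI.
have mb : measurable_fun [set: T] (fun z : T => z.2 <= 0) by exact: measurable_fun_ler.
exact: (mb measurableT [set true]).
Qed.

Let intensity_nonpos i : tier_intensity p i nonpos = 0%E.
Proof.
rewrite /tier_intensity /intensity integral0_eq ?mule0// => x _.
rewrite integral0_eq// => y _; rewrite mark_densityE.
(* Among nonpositive marks the density can be nonzero only at zero, a null point. *)
rewrite -(integral_set1 (fun t => (gamma_density (mark_order p i) t)%:E) 0).
rewrite [RHS]integral_mkcond; apply: eq_integral => t _.
rewrite patchE indicE; have [t0|t0] := ltP 0 t.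
  rewrite !memNset ?mul0r//=; first by move=> h; move: t0; rewrite h ltxx.
  by rewrite /nonpos/= leNgt t0.
rewrite mem_set//= mul1r.
have [->|tn] := eqVneq t 0; first by rewrite mem_set.
rewrite memNset; last by move=> h; move: tn; rewrite h eqxx.
by rewrite /gamma_density ifF//; apply/negbTE; rewrite -ltNge lt_neqAle tn.
Qed.

Lemma count0P (Y : Omega -> nat -> T) A w :
  Defs.count Y A w = 0%E <-> (forall n, ~ A (Y w n)).
Proof.
split=> [h n An|h]; last first.
  by rewrite /Defs.count eseries0// => n _ _; rewrite indicE memNset.
have : (1%:E <= Defs.count Y A w)%E.
  apply: le_trans (nneseries_lim_ge n.+1 _); last by move=> ? _ _; rewrite lee_fin.
  rewrite big_nat_recr//= indicE mem_set//.
  by rewrite leeDr// sume_ge0// => ? _; rewrite lee_fin.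
by rewrite h lee_fin ler10.
Qed.

Definition positive_marks m : set Omega :=
  [set w | forall i, (1 <= i <= m)%N -> forall n, 0 < (X i w n).2].

(** Adds one tier at a time: [nonpos] has intensity zero, so its count is almost surely zero. *)
Lemma positive_marks_as m : (m <= K p)%N ->
  measurable (positive_marks m) /\ P (positive_marks m) = 1%E.
Proof.
elim: m => [_|m IH mK].
  rewrite (_ : positive_marks 0 = setT); last first.
    by apply/seteqP; split => // w _ i; rewrite leqn0; case: i.
  by split => //; exact: probability_setT.
have [mm Pm] := IH (ltnW mK).
have iK : (1 <= m.+1 <= K p)%N by [].
pose B := [set w | Defs.count (X m.+1) nonpos w = 0%E].
have mB : measurable B.
  rewrite -[B]setTI.
  exact: (measurable_count law iK mnonpos measurableT (emeasurable_set1 0%E)).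
have PB : P B = 1%E.
  have := count_distribution law 0 iK mnonpos; rewrite intensity_nonpos => /(_ (ltry _)).
  by rewrite /Defs.poisson_prob expr0 fact0 divr1 mul1r oppr0 expR0.
have -> : positive_marks m.+1 = positive_marks m `&` B.
  apply/seteqP; split => w.
    move=> h; split => [i /andP[i1 im]|]; first by apply: h; rewrite i1 (leq_trans im).
    by apply/count0P => n; rewrite /nonpos/= => /le_gtF; rewrite h ?ltnSn.
  move=> [h /count0P hB] i /andP[i1]; rewrite leq_eqVlt => /predU1P[->|im] n.
    by rewrite ltNge; apply/negP; exact: hB.
  by apply: h; rewrite i1.
split; first exact: measurableI.
by rewrite -(probability_setI1 mm mB PB).
Qed.

(** A rectangle of area [n] whose points all have norm above [a], as their first coordinate exceeds
    [a]. *)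
Let strip (a : R) (n : nat) : set T :=
  [set z | (a < z.1.1 <= a + n%:R) && (0 <= z.1.2 <= 1)].

Let mstrip a n : measurable (strip a n).
Proof.
have m1 : measurable_fun [set: T] (fun z : T => z.1.1).
  by apply: (measurableT_comp measurable_fst); exact: measurable_fst.
have m2 : measurable_fun [set: T] (fun z : T => z.1.2).
  by apply: (measurableT_comp measurable_snd); exact: measurable_fst.
rewrite /strip -[X in measurable X]setTI.
have mb : measurable_fun [set: T] (fun z : T => (a < z.1.1 <= a + n%:R) && (0 <= z.1.2 <= 1)).
  by apply: measurable_and; apply: measurable_and;
    [exact: measurable_fun_ltr|exact: measurable_fun_ler..].
exact: (mb measurableT [set true]).
Qed.

Let intensity_strip i a n : tier_intensity p i (strip a n) = (lam p i * n%:R)%:E.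
Proof.
rewrite /tier_intensity /intensity EFinM; congr (_ * _)%E.
have I1 (x y : R) : (\int[leb]_t (\1_(strip a n) ((x, y), t) * mark_density p i t)%:E =
    (\1_`]a, (a + n%:R)] x * \1_`[0%R, 1%R] y)%:E)%E.
  have b t : (\1_(strip a n) ((x, y), t) : R) = \1_`]a, (a + n%:R)] x * \1_`[0%R, 1%R] y.
    rewrite !indicE -natrM mulnb; congr (nat_of_bool _)%:R.
    apply/idP/idP.
      rewrite inE /strip/= => /andP[h1 h2]; apply/andP.
      by split; rewrite inE/= in_itv/=.
    move=> /andP[]; rewrite !inE/= !in_itv/= => h1 h2.
    by rewrite /strip/= h1 h2.
  under eq_integral do rewrite b.
  rewrite !indicE mark_densityE; case: (x \in _); case: (y \in _) => /=;
    rewrite ?mulr0n ?mulr1n ?mulr1 ?mulr0 ?mul0r; last 3 first.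
  - by rewrite integral0_eq// => t _; rewrite mul0r.
  - by rewrite integral0_eq// => t _; rewrite mul0r.
  - by rewrite integral0_eq// => t _; rewrite mul0r.
  by under eq_integral do rewrite mul1r; rewrite integral_gamma_density// mark_order_gt0.
have mI (J : interval R) : measurable_fun [set: measurableTypeR R]
    (fun y : measurableTypeR R => ((\1_[set` J] y : R)%:E)).
  by apply/measurable_EFinP; exact: measurable_indic.
under eq_integral do under eq_integral do rewrite I1 EFinM.
under eq_integral.
  move=> x _; rewrite ge0_integralZl; [|by []|exact: mI|by move=> y _; rewrite lee_fin|].
  rewrite integral_indic// setIT. over.
  by rewrite lee_fin.
rewrite ge0_integralZr; [|by []|exact: mI|by move=> y _; rewrite lee_fin|exact: measure_ge0].
have l1 : leb `]a, (a + n%:R)]%classic = n%:R%:E.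
  rewrite lebesgue_measure_itv/= lte_fin ltrDl; case: n {I1} => [|n]; first by rewrite ltxx.
  by rewrite ltr0n/= -EFinB addrC addKr.
have l2 : leb `[0%R, 1%R]%classic = 1%:E.
  by rewrite lebesgue_measure_itv/= lte_fin ltr01 oppr0 adde0.
by rewrite integral_indic// setIT [X in (X * _)%E]l1 [X in (_ * X)%E]l2 mule1.
Qed.

Definition far_point i (a : R) : set Omega :=
  [set w | exists n, a < norm2 (X i w n).1].

(** If no point is far, every strip is empty, which has probability at most
    [expR (- (lam p i * n%:R))] for each [n], hence zero. The set [B] provides a measurable event
    inside [far_point]. *)
Lemma far_point_as i a : (1 <= i <= K p)%N ->
  exists B, [/\ measurable B, P B = 1%E & B `<=` far_point i a].
Proof.
move=> iK.
pose Z n := [set w | Defs.count (X i) (strip a n) w = 0%E].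
have mZ n : measurable (Z n).
  rewrite -[Z n]setTI.
  exact: (measurable_count law iK (mstrip a n) measurableT (emeasurable_set1 0%E)).
have PZ n : P (Z n) = (expR (- (lam p i * n%:R)))%:E.
  have := count_distribution law 0 iK (mstrip a n); rewrite intensity_strip => /(_ (ltry _)).
  by rewrite /Defs.poisson_prob expr0 fact0 divr1 mul1r.
have mcap : measurable (\bigcap_n Z n) by exact: bigcapT_measurable.
exists (~` \bigcap_n Z n); split; first exact: measurableC.
- rewrite probability_setC// [X in (_ - X)%E](_ : _ = 0%E) ?sube0//.
  apply/eqP; rewrite eq_le measure_ge0 andbT.
  have cv : expR (- (lam p i * n%:R)) @[n --> \oo] --> (0:R).
    under eq_fun do rewrite -mulNr expRM_natr.
    apply: cvg_expr; rewrite ger0_norm ?expR_ge0// expR_lt1 oppr_lt0.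
    exact: lam0.
  have cvE : (expR (- (lam p i * n%:R)))%:E @[n --> \oo] --> (0:R)%:E.
    by apply: cvg_EFin => //; exact: nearW.
  apply: (@le_trans _ _ (limn (fun n : nat => (expR (- (lam p i * n%:R)))%:E)));
    last by rewrite (cvg_lim _ cvE).
  apply: lime_ge; first by apply/cvg_ex; eexists; exact: cvE.
  by apply: nearW => n; rewrite -PZ; apply: le_measure; rewrite ?inE//; exact: bigcap_inf.
- move=> w h; have [n hn] : exists n, ~ Z n w.
    by apply: contrapT => /forallNP hn; apply: h => n _; exact: contrapT (hn n).
  have [j hj] : exists j, strip a n (X i w j).
    apply: contrapT => /forallNP hj; apply: hn; exact/count0P.
  exists j; move: hj; rewrite /strip/= => /andP[/andP[h1 _] _].
  apply: (lt_le_trans h1); rewrite /norm2; apply: (le_trans (ler_norm _)).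
  by rewrite -sqrtr_sqr; apply: ler_wsqrtr; rewrite lerDl sqr_ge0.
Qed.

End almost_sure.

(** * Coverage probability at a fixed serving distance *)

Section coverage.
Context {R : realType} (p : hetnet_params R) (k : nat) {d : measure_display}
  {Omega : measurableType d} (P : probability Omega R)
  (X : nat -> Omega -> nat -> (R * R) * R) (go : Omega -> R).
Hypothesis kK : (2 <= k <= K p)%N.
Hypothesis N2 : (2 <= N p)%N.
Hypothesis lam0 : forall i, (1 <= i <= K p)%N -> 0 < lam p i.
Hypothesis Pw0 : forall i, (1 <= i <= K p)%N -> 0 < Pw p i.
Hypothesis al2 : forall i, (1 <= i <= K p)%N -> 2 < alpha p i.
Hypothesis noma0 : forall i, (2 <= i <= K p)%N -> [/\ 0 < Bb p i, 0 < am p i & 0 < an p i].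
Hypothesis eta0 : 0 < etaPL p.
Hypothesis sig0 : 0 <= sigma2 p.
Hypothesis law : hetnet_law p P X go.
Variable x : R.
Hypothesis x0 : 0 < x.
Notation T := ((R * R) * R)%type.

Let in1 i : (2 <= i <= K p)%N -> (1 <= i <= K p)%N.
Proof. by move=> /andP[i2 ->]; rewrite (ltnW i2). Qed.

Let k1 : (1 <= k <= K p)%N := in1 kK.

Let oneK : (1 <= 1 <= K p)%N.
Proof. by case/andP: kK => k2 /(leq_trans k2)/ltnW ->. Qed.

Let N0 : (0 < N p)%N := ltn_trans (ltn0Sn 0) N2.

Definition scale (eps : R) : R := eps * x `^ alpha p k / (Pw p k * etaPL p).

Lemma scale_gt0 eps : 0 < eps -> 0 < scale eps.
Proof.
move=> e0; apply: divr_gt0; first by apply: mulr_gt0 => //; exact: powR_gt0.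
by apply: mulr_gt0 => //; exact: Pw0.
Qed.

(** The value zero outside the tiers [1] to [K p] secures nonnegativity at every index, the powers
    being known positive only on the tiers. *)
Definition scaled_power (eps : R) (i : nat) (z : T) : R :=
  if (1 <= i <= K p)%N then
    if i == 1%N then faded (scale eps * (Pw p 1 / (N p)%:R * etaPL p)) (omega_1k p k x) (alpha p 1) z
    else faded (scale eps * (Pw p i * etaPL p)) (omega_ik p i k x) (alpha p i) z
  else 0.

Lemma scaled_power_ge0 eps i z : 0 < eps -> 0 <= scaled_power eps i z.
Proof.
move=> e0; have s0 := scale_gt0 e0; rewrite /scaled_power; case: ifPn => // iK.
case: ifPn => _; apply: faded_ge0; apply: mulr_ge0 (ltW s0) _.
  by apply: mulr_ge0 (ltW eta0); apply: divr_ge0 => //; exact/ltW/Pw0.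
by apply: mulr_ge0 (ltW eta0); exact/ltW/Pw0.
Qed.

Lemma measurable_scaled_power eps i : measurable_fun setT (scaled_power eps i).
Proof.
rewrite /scaled_power; have [iK|iK] := boolP (1 <= i <= K p)%N; last exact: measurable_cst.
by have [_|_] := boolP (i == 1%N); exact: measurable_faded.
Qed.

Lemma scaled_power_laplace eps : 0 < eps ->
  P [set w | ((scale eps * sigma2 p)%:E + shot p X (scaled_power eps) w < (go w)%:E)%E] =
  (Pform p k eps (complex.Re (Qmacro p k eps)) x)%:E.
Proof.
move=> e0; have Pk0 : Pw p k != 0 by rewrite gt_eqF// Pw0.
have et0 : etaPL p != 0 by rewrite gt_eqF.
have n0 : (N p)%:R != 0 :> R by rewrite pnatr_eq0 -lt0n.
pose phi i := if i == 1%N then macro_exponent p k x eps else small_exponent p k x eps i.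
rewrite (@ppp_laplace_transform _ p _ _ P X go law lam0 N0 _ _ phi).
- congr EFin; rewrite /Pform; congr expR.
  rewrite big_ltn; last by rewrite ltnS; case/andP: oneK.
  rewrite {1}/phi eqxx !opprD addrA; congr (_ - _ - _).
    by congr (- _); rewrite /scale; field; rewrite Pk0 et0.
  rewrite !big_nat; apply: eq_bigr => i /andP[i2 _].
  by rewrite /phi gtn_eqF.
- exact: measurable_scaled_power.
- by move=> i z; exact: scaled_power_ge0.
- by apply: mulr_ge0 => //; exact/ltW/scale_gt0.
- move=> i iK; rewrite /scaled_power /phi iK; case: (eqVneq i 1%N) => [->|i1].
    rewrite (_ : scale eps * _ = eps * Pt p 1 k / (N p)%:R * x `^ alpha p k); last first.
      by rewrite /scale /Pt; field; rewrite Pk0 et0 n0.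
    exact: (laplace_exponent_macro kK N2 Pw0 al2 noma0 x0 e0).
  have i2 : (2 <= i <= K p)%N.
    by case/andP: iK => i0 ->; rewrite ltn_neqAle eq_sym i1 i0.
  rewrite (_ : scale eps * _ = eps * Pt p i k * x `^ alpha p k); last first.
    by rewrite /scale /Pt; field; rewrite Pk0 et0.
  exact: (laplace_exponent_small kK N2 Pw0 al2 noma0 x0 e0 i2).
Qed.

Definition interference (w : Omega) : \bar R := (I_M p k X x w + I_S p k X x w)%E.

Lemma I_ME w : I_M p k X x w = (\sum_(n <oo)
  (received (Pw p 1 / (N p)%:R * etaPL p) (omega_1k p k x) (alpha p 1) (X 1%N w n))%:E)%E.
Proof.
apply: eq_eseriesr => n _; rewrite /received; case: ifP => // _.
by congr EFin; ring.
Qed.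

Lemma I_SE w : I_S p k X x w = (\sum_(2 <= i < (K p).+1) \sum_(n <oo)
  (received (Pw p i * etaPL p) (omega_ik p i k x) (alpha p i) (X i w n))%:E)%E.
Proof.
apply: eq_bigr => i _; apply: eq_eseriesr => n _; rewrite /received; case: ifP => // _.
by congr EFin; ring.
Qed.

Lemma measurable_interference : measurable_fun setT interference.
Proof.
have mX i n : (1 <= i <= K p)%N -> measurable_fun setT (fun w => X i w n) := @proj1 _ _ law i n.
have mS i c w0 al : (1 <= i <= K p)%N ->
    measurable_fun setT (fun w => (\sum_(n <oo) (received c w0 al (X i w n))%:E)%E).
  move=> iK; apply: (@measurable_fun_limn _ _ _
    (fun n w => (\sum_(0 <= j < n) (received c w0 al (X i w j))%:E)%E)) => n.
  apply: emeasurable_sum => j; apply/measurable_EFinP.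
  exact: (measurableT_comp (@measurable_received _ c w0 al) (mX i j iK)).
have mIM : measurable_fun setT (fun w => I_M p k X x w).
  under eq_fun do rewrite I_ME.
  exact: mS.
have mIS : measurable_fun setT (fun w => I_S p k X x w).
  rewrite (_ : (fun w => I_S p k X x w) = fun w => (\sum_(2 <= i < (K p).+1)
    (if (1 <= i <= K p)%N then \sum_(n <oo)
      (received (Pw p i * etaPL p) (omega_ik p i k x) (alpha p i) (X i w n))%:E else 0))%E).
    apply: emeasurable_sum => i; have [iK|iK] := boolP (1 <= i <= K p)%N; last exact: measurable_cst.
    exact: mS.
  apply/funext => w; rewrite I_SE !big_nat; apply: eq_bigr => i /andP[i2 iK].
  by rewrite ifT//; apply/andP; split; first exact: ltnW.
exact: emeasurable_funD.
Qed.

(** With positive marks the clipping in [faded] is inactive and all series are nonnegative, so that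
    tiers and points may be summed in either order and the scale factored out. *)
Lemma shot_scaled_power eps w : 0 < eps -> positive_marks X (K p) w ->
  shot p X (scaled_power eps) w = ((scale eps)%:E * interference w)%E.
Proof.
move=> e0 wpos; have s0 := scale_gt0 e0.
have rec0 c om al i n : 0 <= c -> (1 <= i <= K p)%N -> 0 <= received c om al (X i w n).
  move=> c0 iK; rewrite /received; case: ifP => // _.
  by rewrite !mulr_ge0 ?powR_ge0// ltW// wpos.
have c10 : 0 <= Pw p 1 / (N p)%:R * etaPL p.
  by apply: mulr_ge0 (ltW eta0); apply: divr_ge0 => //; exact/ltW/Pw0.
have ci0 i : (2 <= i <= K p)%N -> 0 <= Pw p i * etaPL p.
  by move=> iK; apply: mulr_ge0 (ltW eta0); exact/ltW/Pw0/in1.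
rewrite /shot nneseries_sum_nat; last first.
  by move=> i n; rewrite lee_fin; exact: scaled_power_ge0.
rewrite big_ltn; last by rewrite ltnS; case/andP: oneK.
rewrite /interference I_ME I_SE ge0_muleDr; last 2 first.
- by apply: nneseries_ge0 => n _ _; rewrite lee_fin rec0.
- rewrite big_nat; apply: sume_ge0 => i /andP[i2 iK]; apply: nneseries_ge0 => n _ _.
  by rewrite lee_fin rec0 ?in1 ?ci0// i2.
congr (_ + _)%E.
  rewrite -nneseriesZl; last by move=> n _; rewrite lee_fin rec0.
  apply: eq_eseriesr => n _; rewrite /scaled_power oneK eqxx.
  by rewrite faded_received ?EFinM// ltW// wpos.
rewrite big_nat [in RHS]big_nat ge0_sume_distrr; last first.
  move=> i /andP[i2 iK]; apply: nneseries_ge0 => n _ _.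
  by rewrite lee_fin rec0 ?in1 ?ci0// i2.
apply: eq_bigr => i /andP[i2 iK]; have iK2 : (2 <= i <= K p)%N by rewrite i2.
rewrite -nneseriesZl; last by move=> n _; rewrite lee_fin rec0 ?in1 ?ci0.
apply: eq_eseriesr => n _; rewrite /scaled_power in1// gtn_eqF//.
by rewrite faded_received ?EFinM// ltW// wpos// in1.
Qed.

(** A single point of tier [k] outside its exclusion disk already contributes a positive term. *)
Lemma shot_scaled_power_gt0 eps w : 0 < eps -> positive_marks X (K p) w ->
  far_point X k (omega_ik p k k x) w -> (0 < shot p X (scaled_power eps) w)%E.
Proof.
move=> e0 wpos [j hj]; have s0 := scale_gt0 e0.
have g0 i z := @scaled_power_ge0 eps i z e0.
have tpos : 0 < scaled_power eps k (X k w j).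
  rewrite /scaled_power k1 gtn_eqF; last by case/andP: kK.
  rewrite /faded hj max_l; last by rewrite ltW// wpos.
  apply: mulr_gt0; last first.
    by apply: powR_gt0; apply: lt_trans hj; exact: (omega_ik_gt0 kK Pw0 noma0 x0 kK).
  apply: mulr_gt0; last exact: wpos.
  by apply: mulr_gt0 => //; apply: mulr_gt0 => //; exact: Pw0.
apply: (@lt_le_trans _ _ (scaled_power eps k (X k w j))%:E); first by rewrite lte_fin.
apply: le_trans (nneseries_lim_ge j.+1 _); last first.
  by move=> n _ _; apply: sume_ge0 => i _; rewrite lee_fin.
rewrite big_nat_recr//=; apply: (@le_trans _ _ (\sum_(1 <= i < (K p).+1) (scaled_power eps i (X i w j))%:E)%E).
  rewrite (bigD1_seq k)/= ?iota_uniq ?mem_index_iota ?ltnS//.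
  by rewrite leeDl// sume_ge0// => i _; rewrite lee_fin.
by rewrite leeDr// sume_ge0// => n _; apply: sume_ge0 => i _; rewrite lee_fin.
Qed.

(** Positive interference matters when the noise power is zero: it keeps the SINR denominators
    positive. *)
Lemma good_event : exists W : set Omega, [/\ measurable W, P W = 1%E &
  forall w, W w -> [/\ 0 < go w, positive_marks X (K p) w & (0 < interference w)%E]].
Proof.
have [mpos Ppos] := positive_marks_as law (leqnn (K p)).
have [B [mB PB Bfar]] := far_point_as law lam0 N0 (omega_ik p k k x) k1.
pose G := [set w | 0 < go w].
have mG : measurable G.
  rewrite -[G]setTI.
  have := proj1 (proj2 law) measurableT _ (measurable_itv `]0, +oo[).
  by congr measurable; apply/seteqP; split => w /=; rewrite in_itv/= andbT.
have PG : P G = 1%E by rewrite (tail_serving_fading law)// oppr0 expR0.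
have mPB := measurableI _ _ mpos mB.
exists (positive_marks X (K p) `&` B `&` G); split.
- exact: measurableI.
- by rewrite -(probability_setI1 mPB mG PG) -(probability_setI1 mpos mB PB).
- move=> w [[wpos /Bfar wB] wG]; split => //.
  have := shot_scaled_power_gt0 ltr01 wpos wB.
  by rewrite (shot_scaled_power ltr01 wpos) pmule_rgt0// lte_fin scale_gt0.
Qed.

Lemma coverage_prob eps (E : set Omega) : 0 < eps -> measurable E ->
  (forall w, 0 < go w -> (0 < interference w)%E ->
     (E w <-> ((scale eps * sigma2 p)%:E + (scale eps)%:E * interference w < (go w)%:E)%E)) ->
  fine (P E) = Pform p k eps (complex.Re (Qmacro p k eps)) x.
Proof.
move=> e0 mE hE; have [W [mW PW HW]] := good_event.
pose F := [set w | ((scale eps * sigma2 p)%:E + shot p X (scaled_power eps) w < (go w)%:E)%E].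
have mF : measurable F.
  apply: (measurable_shot_event law); first exact: measurable_scaled_power.
  by move=> i z; exact: scaled_power_ge0.
have EF : E `&` W = F `&` W.
  have key w : W w -> (E w <-> F w).
    move=> /HW[wG wpos wI].
    by rewrite /F/= (shot_scaled_power e0 wpos); apply: hE.
  by apply/seteqP; split => w [h1 h2]; split => //; apply/(key w h2).
by rewrite (probability_setI1 mE mW PW) EF -(probability_setI1 mF mW PW) scaled_power_laplace.
Qed.

Lemma coverage_prob0 (E : set Omega) : measurable E ->
  (forall w, 0 < go w -> (0 < interference w)%E -> ~ E w) -> fine (P E) = 0.
Proof.
move=> mE hE; have [W [mW PW HW]] := good_event.
rewrite (probability_setI1 mE mW PW) (_ : E `&` W = set0) ?measure0//.
by apply/seteqP; split => // w [h1 /HW[h2 _ h3]]; exact: hE h1.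
Qed.

Lemma sinrE (num base noise : R) (I : \bar R) :
  sinr num base I noise = if I \is a fin_num then num / (base + fine I + noise) else 0.
Proof. by case: I. Qed.

Lemma measurable_sinr (num base : Omega -> R) : measurable_fun setT num ->
  measurable_fun setT base ->
  measurable_fun setT (fun w => sinr (num w) (base w) (interference w) (sigma2 p)).
Proof.
move=> mn mb; under eq_fun do rewrite sinrE.
apply: measurable_fun_ifT => //.
  apply: (measurable_fun_bool true).
  rewrite (_ : _ @^-1` _ = [set w | interference w \is a fin_num]); last first.
    by apply/seteqP; split => w.
  exact: (emeasurable_fin_num measurableT measurable_interference).
apply: measurable_funM => //.
apply: (@measurableT_comp _ _ _ _ _ _ (fun y : R => y^-1) _ _ (@measurable_invr R)).
apply: measurable_funD => //; apply: measurable_funD => //.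
exact: (measurableT_comp (fine_measurable measurableT) measurable_interference).
Qed.

Let S (w : Omega) : R := Pw p k * go w * etaPL p * x `^ (- alpha p k).

Let S_gt0 w : 0 < go w -> 0 < S w.
Proof.
move=> g0; apply: mulr_gt0; last exact: powR_gt0.
by apply: mulr_gt0 => //; apply: mulr_gt0 => //; exact: Pw0.
Qed.

Let mS : measurable_fun setT S.
Proof.
apply: measurable_funM => //; apply: measurable_funM => //; apply: measurable_funM => //.
exact: (proj1 (proj2 law)).
Qed.

Let mSc (c : R) : measurable_fun setT (fun w => c * S w).
Proof. exact: measurable_funM. Qed.

Let threshold_scale eps D w : (scale eps * D < go w) = (eps * D < S w).
Proof.
have xa0 : 0 < x `^ alpha p k by exact: powR_gt0.
have PE0 : 0 < Pw p k * etaPL p by apply: mulr_gt0 => //; exact: Pw0.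
rewrite /scale /S powRN [_ / _ * D]mulrAC ltr_pdivrMr// ltr_pdivlMr//.
by congr (_ < _); ring.
Qed.

(** Infinite interference makes both sides false; otherwise this is a rearrangement between real
    numbers. *)
Let threshold_event eps (I : \bar R) w : 0 < eps -> (0 < I)%E ->
  ((scale eps * sigma2 p)%:E + (scale eps)%:E * I < (go w)%:E)%E =
  (I \is a fin_num) && (eps * (fine I + sigma2 p) < S w).
Proof.
move=> e0; case: I => [r| |]//=.
  by rewrite lte_fin => r0; rewrite -EFinM -EFinD lte_fin -mulrDr addrC threshold_scale.
by move=> _; rewrite mulry gtr0_sg ?scale_gt0// mul1e.
Qed.

Let den_gt0 w : (0 < interference w)%E -> interference w \is a fin_num ->
  0 < fine (interference w) + sigma2 p.
Proof. by case: (interference w) => //= z; rewrite lte_fin => z0 _; rewrite ltr_wpDr. Qed.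

Lemma cond_cov_near (r tauc taut : R) : x <= r -> 0 < tauc -> 0 < taut ->
  cond_cov p k r tauc taut P X go x = Pnear p k tauc taut x.
Proof.
move=> xr tc0 tt0; rewrite /cond_cov xr /Pnear.
have [Bk0 am0 an0] := noma0 kK.
set E := [set w | _].
have mE : measurable E.
  rewrite -[E]setTI.
  have mb : measurable_fun setT (fun w => (tauc < sinr (am p k * S w) (an p k * S w) (interference w) (sigma2 p))
      && (taut < sinr (an p k * S w) 0 (interference w) (sigma2 p))).
    by apply: measurable_and; apply: measurable_fun_ltr => //; exact: measurable_sinr.
  exact: (mb measurableT [set true]).
case: ifPn => [A0|]; last first.
  rewrite -ltNge => A0.
  have e0 : 0 < eps_star p k tauc taut by rewrite lt_max [0 < eps_tn _ _ _]divr_gt0 ?orbT.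
  apply: coverage_prob => // w g0 I0.
  rewrite threshold_event// /E/= -/(S w) -/(interference w) !sinrE.
  (* Infinite interference gives SINR zero, below the positive threshold. *)
  case: ifPn => [fI|_] /=; last by rewrite ltNge (ltW tc0).
  by rewrite -!addrA near_threshold ?S_gt0 ?den_gt0.
apply: coverage_prob0 => // w g0 I0; rewrite /E/= -/(S w) -/(interference w) !sinrE.
case: ifPn => [fI|_] /=; last by rewrite ltNge (ltW tc0).
by rewrite -!addrA ratio_saturated ?S_gt0 ?den_gt0.
Qed.

Lemma cond_cov_far (r tauc taut : R) : r < x -> 0 < taut ->
  cond_cov p k r tauc taut P X go x = Pfar p k taut x.
Proof.
move=> rx tt0; rewrite /cond_cov leNgt rx /= /Pfar.
have [Bk0 am0 an0] := noma0 kK.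
set E := [set w | _].
have mE : measurable E.
  rewrite -[E]setTI.
  have mb : measurable_fun setT (fun w => taut < sinr (am p k * S w) (an p k * S w) (interference w) (sigma2 p)).
    by apply: measurable_fun_ltr => //; exact: measurable_sinr.
  exact: (mb measurableT [set true]).
case: ifPn => [A0|]; last first.
  rewrite -ltNge => A0.
  have e0 : 0 < eps_tf p k taut by rewrite divr_gt0.
  apply: coverage_prob => // w g0 I0.
  rewrite threshold_event// /E/= -/(S w) -/(interference w) !sinrE.
  case: ifPn => [fI|_] /=; last by rewrite ltNge (ltW tt0).
  by rewrite -!addrA ratio_threshold ?S_gt0 ?den_gt0.
apply: coverage_prob0 => // w g0 I0; rewrite /E/= -/(S w) -/(interference w) !sinrE.
case: ifPn => [fI|_] /=; last by rewrite ltNge (ltW tt0).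
by rewrite -!addrA ratio_saturated ?S_gt0 ?den_gt0.
Qed.

End coverage.

(** * Integration over the serving distance *)

Section measurable_formula.
Context {R : realType} (p : hetnet_params R) (k : nat).

Lemma measurable_Pform eps Q : measurable_fun setT (Pform p k eps Q).
Proof.
apply: measurableT_comp => //; apply: measurable_funB; first apply: measurable_funB.
- apply: measurableT_comp => //; apply: measurable_funM => //.
  apply: measurable_funM => //; apply: measurable_funM => //; exact: measurable_powR_fun.
- by apply: measurable_funM => //; apply: measurable_funM => //; exact: measurable_powR_fun.
- apply: measurable_sum => i; apply: measurable_funM => //; apply: measurable_funM => //.
  by apply: measurable_funM => //; exact: measurable_powR_fun.
Qed.

Lemma measurable_f_do : measurable_fun setT (f_do p k).
Proof.
apply: measurable_funM => //; apply: measurable_funM.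
  exact: measurable_funM.
apply: measurableT_comp => //; apply: measurable_funB.
  apply: measurable_funM => //; apply: measurable_sum => i.
  by apply: measurable_funM => //; exact: measurable_powR_fun.
by apply: measurable_funM => //; exact: measurable_powR_fun.
Qed.

Lemma f_do_ge0 x : 0 < lam p k -> 0 <= x -> 0 <= f_do p k x.
Proof.
move=> l0 x0.
have D0 y : 0 <= y -> 0 <= dens_unnorm p k y.
  by move=> y0; rewrite !mulr_ge0 ?expR_ge0 ?pi_ge0// ltW.
rewrite divr_ge0 ?D0//; apply: Rintegral_ge0 => y /=.
by rewrite in_itv/= andbT; exact: D0.
Qed.

Lemma Pnear_ge0 tauc taut x : 0 <= Pnear p k tauc taut x.
Proof. by rewrite /Pnear; case: ifP => // _; exact: expR_ge0. Qed.

Lemma Pfar_ge0 taut x : 0 <= Pfar p k taut x.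
Proof. by rewrite /Pfar; case: ifP => // _; exact: expR_ge0. Qed.

Lemma measurable_Pnear tauc taut : measurable_fun setT (Pnear p k tauc taut).
Proof.
rewrite /Pnear; case: (_ <= 0); [exact: measurable_cst|exact: measurable_Pform].
Qed.

Lemma measurable_Pfar taut : measurable_fun setT (Pfar p k taut).
Proof.
rewrite /Pfar; case: (_ <= 0); [exact: measurable_cst|exact: measurable_Pform].
Qed.

End measurable_formula.

Theorem theorem1 (R : realType) (p : hetnet_params R) (k : nat) (Rt Rc r : R)
    (d : measure_display) (Omega : measurableType d) (P : probability Omega R)
    (X : nat -> Omega -> nat -> (R * R) * R) (go : Omega -> R) :
  (2 <= K p)%N -> (2 <= k <= K p)%N ->
  (2 <= N p)%N -> (N p < M p)%N ->
  (forall i, (1 <= i <= K p)%N -> 0 < lam p i) ->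
  (forall i, (1 <= i <= K p)%N -> 0 < Pw p i) ->
  (forall i, (1 <= i <= K p)%N -> 2 < alpha p i) ->
  (forall i, (2 <= i <= K p)%N -> [/\ 0 < Bb p i, 0 < am p i & 0 < an p i]) ->
  0 < etaPL p -> 0 <= sigma2 p ->
  0 < Rt -> 0 < Rc -> 0 < r ->
  hetnet_law p P X go ->
  let taut := 2 `^ Rt - 1 in
  let tauc := 2 `^ Rc - 1 in
  [/\ Qmacro_Im p k (eps_star p k tauc taut) = 0,
      Qmacro_Im p k (eps_tf p k taut) = 0 &
      Pcov p k r tauc taut P X go =
      (\int[@lebesgue_measure R]_(x0 in `[0%R, r]) (Pnear p k tauc taut x0 * f_do p k x0)%:E
       + \int[@lebesgue_measure R]_(x0 in `]r, +oo[) (Pfar p k taut x0 * f_do p k x0)%:E)%E].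
Proof.
move=> _ kK N2 _ lam0 Pw0 al2 noma0 eta0 sig0 Rt0 Rc0 r0 law taut tauc.
have tau0 (y : R) : 0 < y -> 0 < 2 `^ y - 1.
  move=> y0; rewrite subr_gt0 -[ltLHS](powRr0 2) /powR pnatr_eq0/= mul0r ltr_expR.
  by rewrite mulr_gt0// ln_gt0// ltr1n.
have k1 : (1 <= k <= K p)%N by case/andP: kK => k2 ->; rewrite (ltnW k2).
split; [exact: Qmacro_Im0|exact: Qmacro_Im0|].
(* The near and far formulas are glued into one integrand, and the half-line is cut at [r] only
   after the conditional coverage has been replaced. *)
pose g (y : R) : R := (if y <= r then Pnear p k tauc taut y else Pfar p k taut y) * f_do p k y.
have mg : measurable_fun setT g.
  apply: measurable_funM; last exact: measurable_f_do.
  apply: measurable_fun_ifT; first exact: measurable_fun_ler.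
    exact: measurable_Pnear.
  exact: measurable_Pfar.
have g0 y : 0 <= y -> 0 <= g y.
  move=> y0; apply: mulr_ge0; last by apply: f_do_ge0 => //; exact: lam0.
  by case: ifP => _; [exact: Pnear_ge0|exact: Pfar_ge0].
have -> : Pcov p k r tauc taut P X go =
    (\int[@lebesgue_measure R]_(y in `[0%R, +oo[) (g y)%:E)%E.
  apply: eq_integral => y; rewrite inE/= in_itv/= andbT le_eqVlt => /predU1P[<-|y0].
    (* At [y = 0], where the conditional formulas do not apply, the density vanishes. *)
    by rewrite /g /f_do /dens_unnorm !(mulr0, mul0r).
  congr EFin; rewrite /g; congr (_ * _); case: leP => yr.
    by apply: cond_cov_near => //; exact: tau0.
  by apply: cond_cov_far => //; exact: tau0.
have mgE (D : set R) : measurable_fun D (fun y => (g y)%:E).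
  by apply/measurable_EFinP; exact: measurable_funTS.
have -> : `[0%R, +oo[%classic = `[0%R, r]%classic `|` `]r, +oo[%classic :> set R.
  apply/seteqP; split => y /=; rewrite !in_itv/= !andbT.
    by move=> y0; case: (leP y r) => yr; [left; rewrite y0|right].
  by move=> [/andP[]//|ry]; rewrite ltW// (lt_trans r0).
rewrite ge0_integral_setU//; last 3 first.
- exact: mgE.
- move=> y /= [|]; rewrite in_itv/= ?andbT => h; rewrite lee_fin; apply: g0.
    by case/andP: h.
  by rewrite ltW// (lt_trans r0).
- apply/disj_setPS => y /= []; rewrite !in_itv/= andbT => /andP[_ h1] h2.
  by move: h1; rewrite leNgt h2.
congr (_ + _)%E; apply: eq_integral => y; rewrite inE/= in_itv/= ?andbT /g.
  by move=> /andP[_ ->].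
by move=> ry; rewrite leNgt ry.
Qed.
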